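(* Let $\phi(\rho,\beta,z)=\sum_{n\ge 0}\frac{z^n}{n!\,\Gamma(\rho n+\beta)}$ denote the Wright function, for real $\rho>-1$ and $\beta\in\mathbb{R}$. If $\rho>0$ and $\beta>0$, then all zeros of the entire function $z\mapsto\phi(\rho,\beta,-z)$ are real and positive. Moreover, if $0<\rho\le 1$ and $\beta>0$, then the entire function $z\mapsto\phi(\rho,-\beta,-z)$ has $[\beta]+1$ non-positive zeros.
   Context: $1/\Gamma$ is the (entire) reciprocal gamma function, so that $1/\Gamma$ vanishes at $0,-1,-2,\dots$, and the Wright series is well defined for all real $\beta$. $[x]$ denotes the integer part (floor) of $x$. A ''non-positive zero'' of an entire function is a zero in $\mathbb{C}$ that does not lie in $(0,\infty)$, i.e. a zero that is nonreal, negative or equal to $0$; zeros are counted with multiplicity. *)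

(* Defs.v *)
From HB Require Import structures.
From mathcomp Require Import all_boot all_order all_algebra.
From mathcomp Require Import complex.
From mathcomp Require Import all_classical all_reals all_analysis.
Set Implicit Arguments.
Unset Strict Implicit.
Unset Printing Implicit Defensive.
Import Order.TTheory GRing.Theory Num.Theory numFieldNormedType.Exports.
Local Open Scope classical_set_scope.
Local Open Scope ring_scope.

(* R[i] packaged so that the topology of numeric fields applies to it.  Its
   order is partial: 0 < z means that z is real and positive. *)
Definition Cplx (R : realType) : numClosedFieldType := R[i].

(* Gauss: 1 / Gamma(x) = lim_n x (x + 1) ... (x + n) / (n! n^x), an identity
   valid for every x, poles of Gamma included. *)
Definition rGamma (R : realType) (x : R) : R :=
  limn (fun n => (\prod_(k < n.+1) (x + k%:R)) / (n`!%:R * n%:R `^ x)).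

Definition Wright (R : realType) (rho beta : R) (z : Cplx R) : Cplx R :=
  limn (series (fun n =>
    ((rGamma (rho * n%:R + beta))%:C%C : Cplx R) * z ^+ n / n`!%:R)).

(* Meaningful for f analytic at z; m = 0 when f z <> 0. *)
Definition zero_order (C : numClosedFieldType) (f : C -> C) (z : C) (m : nat) :
    Prop :=
  (forall k, (k < m)%N -> derive1n k f z = 0) /\ derive1n m f z <> 0.

(* f has finitely many zeros outside ]0, +oo[, and their multiplicities add
   up to N. *)
Definition nonpos_zero_count (C : numClosedFieldType) (f : C -> C) (N : nat) :
    Prop :=
  exists (s : seq C) (m : C -> nat),
    [/\ uniq s,
        forall z, z \in s <-> f z = 0 /\ ~ 0 < z,
        forall z, z \in s -> zero_order f z (m z) &
        (\sum_(z <- s) m z)%N = N].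

(* Main.v *)
Require Import Defs.
From HB Require Import structures.
From mathcomp Require Import all_boot all_order all_algebra.
From mathcomp Require Import complex.
From mathcomp Require Import all_classical all_reals all_analysis.
From mathcomp Require Import ring lra zify.
Set Implicit Arguments.
Unset Strict Implicit.
Unset Printing Implicit Defensive.
Import Order.TTheory GRing.Theory Num.Theory numFieldNormedType.Exports.
Local Open Scope classical_set_scope.
Local Open Scope ring_scope.

(* Since 1/Gamma(x) = lim_m x (x+1) ... (x+m) / (m! m^x), the coefficients of
   phi(rho, b, -z) are limits of those of polynomials P_m obtained, up to a
   rescaling of z, from (1 - z/d)^d, d = m+1, by the operators rho z d/dz + b + k,
   0 <= k <= m.  Up to a factor, rho z p' + b p is the derivative of
   z^(b/rho) p, so by the mean value theorem such an operator preserves the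
   number of sign alternations on ]0, d[ of a polynomial vanishing at d, and
   increases it by one when b > 0.  Hence, up to a power of z, P_m is the product
   of prod_j (1 - u_j z), u_j > 0, and of a polynomial of degree at most the
   number of k with b + k <= 0 (minus the exponent of the power of z).
   The roots of P_m stay away from 0, which bounds sum_j u_j; along an
   ultrafilter both factors converge, and the limit of the first one has no
   zero outside ]0, +oo[.  This bounds the number of nonpositive zeros from above.
   Conversely, multiplying a power series by 1 - u z with u > 0 does not increase
   the number of sign changes of its coefficients after the substitution
   z -> -z; for rho <= 1 those of phi(rho, -beta, z) change sign sufficiently
   often for the bound to be attained. *)
Import ComplexField.Normc.
Local Arguments normc : simpl never.

(** * The reciprocal Gamma function *)

Section Gamma.
Variable R : realType.
Implicit Types x : R.

Definition gauss x (m : nat) : R :=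
  (\prod_(k < m.+1) (x + k%:R)) / (m`!%:R * m%:R `^ x).

Lemma gauss_ge0 x m : 0 <= x -> 0 <= gauss x m.
Proof.
move=> x0; rewrite /gauss divr_ge0 ?mulr_ge0 ?powR_ge0// ?prodr_ge0// => k _.
by rewrite addr_ge0.
Qed.

(** The ratio of consecutive terms is (1 + x/(m+1)) (m/(m+1))^x, where 1 + x/(m+1) <= exp(x/(m+1))
    and ln(m/(m+1)) <= -1/(m+1). *)
Lemma gauss_decr x m : 0 <= x -> (0 < m)%N -> gauss x m.+1 <= gauss x m.
Proof.
move=> x0 m0.
have m0R : 0 < m%:R :> R by rewrite ltr0n.
have m1R : 0 < m.+1%:R :> R by rewrite ltr0n.
rewrite /gauss big_ord_recr /= factS natrM invfM invfM.
set p := \prod_(_ < _) _.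
have p0 : 0 <= p by apply: prodr_ge0 => k _; rewrite addr_ge0.
have := powR_gt0 x m0R; have := powR_gt0 x m1R.
set q' := m.+1%:R `^ x; set q := m%:R `^ x => q'0 q0.
have f0 : 0 < m`!%:R :> R by rewrite ltr0n fact_gt0.
rewrite [leRHS](_ : _ = p * m`!%:R^-1 / q'* (q' / q)); last first.
  by field; rewrite !gt_eqF.
rewrite [leLHS](_ : _ = p * m`!%:R^-1 / q' * (1 + x / m.+1%:R)); last first.
  by rewrite -natr1; field; rewrite natr1 !gt_eqF.
apply: ler_wpM2l; first by rewrite !mulr_ge0 ?invr_ge0// ltW.
apply: (@le_trans _ _ (expR (x / m.+1%:R))); first exact: expR_ge1Dx.
rewrite /q /q' /powR !gt_eqF // -expRB ler_expR -mulrBr ler_wpM2l //.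
rewrite -[leRHS]opprB lerNr -ln_div ?posrE //.
have -> : m%:R / m.+1%:R = 1 + - m.+1%:R^-1 :> R.
  by rewrite -natr1; field; rewrite natr1 gt_eqF.
apply: le_ln1Dx; rewrite ltrN2 invf_lt1 ?posrE // ltr1n.
by rewrite ltnS.
Qed.

(** By monotonicity the term at m = 1 dominates. The bound is uniform in m and quadratic in x, as
    needed for the coefficients of the approximations. *)
Lemma gauss_le x m : 0 <= x -> (0 < m)%N -> gauss x m <= x * (x + 1).
Proof.
move=> x0; elim: m => // -[_ _|m IH _].
  by rewrite /gauss !big_ord_recr big_ord0 /= powR1 mulr1 divr1 addr0 mul1r.
exact: le_trans (gauss_decr _ _) (IH _).
Qed.

Lemma gaussS x m : (0 < m)%N ->
  gauss x m * (x + m.+1%:R) = x * gauss (x + 1) m * m%:R.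
Proof.
move=> m0; have m0R : 0 < m%:R :> R by rewrite ltr0n.
have f0 : 0 < m`!%:R :> R by rewrite ltr0n fact_gt0.
rewrite /gauss powRD ?(gt_eqF m0R) ?implybT // powRr1 ?ltW //.
have e : \prod_(k < m.+1) (x + k%:R) * (x + m.+1%:R) =
    x * \prod_(k < m.+1) (x + 1 + k%:R).
  transitivity (\prod_(k < m.+2) (x + k%:R)); first by rewrite [RHS]big_ord_recr.
  rewrite big_ord_recl /= addr0.
  by congr (_ * _); apply: eq_bigr => k _; rewrite /bump /= natrD addrA.
rewrite mulrAC e.
field; rewrite !gt_eqF //; exact: powR_gt0.
Qed.

Lemma gauss_cvg_ge0 x : 0 <= x -> cvgn (gauss x).
Proof.
move=> x0.
have : cvgn (fun n => gauss x n.+1).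
  apply: nonincreasing_is_cvgn.
    by apply/nonincreasing_seqP => n; exact: gauss_decr.
  by exists 0 => _ [n _ <-]; exact: gauss_ge0.
by move=> /cvg_ex[l cl]; apply/cvg_ex; exists l; rewrite -cvg_shiftS.
Qed.

(** By [gaussS], gauss x m = x gauss (x+1) m / (1 + (x+1)/m), and the denominator tends to 1.
    Convergence thus spreads leftwards from x >= 0 to the whole line, poles of Gamma included. *)
Lemma gauss_step_cvg x (l : R) : gauss (x + 1) @ \oo --> l -> gauss x @ \oo --> x * l.
Proof.
move=> cl.
have c0 : (fun m => 1 + (x + 1) * m%:R^-1) @ \oo --> (1 + (x + 1) * 0 : R).
  apply: cvgD; first exact: cvg_cst.
  apply: cvgMr; rewrite -(cvg_shiftS (fun m => m%:R^-1 : R)) /=.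
  exact: cvg_harmonic.
have c1 : (fun m => x * gauss (x + 1) m / (1 + (x + 1) * m%:R^-1)) @ \oo --> x * l.
  have -> : x * l = x * l / (1 + (x + 1) * 0) by rewrite mulr0 addr0 divr1.
  apply: cvgM; first exact: cvgMr.
  by apply: cvgV => //; rewrite mulr0 addr0 oner_neq0.
apply: cvg_trans c1; apply: near_eq_cvg.
near=> m.
have m0 : (0 < m)%N by near: m; exact: nbhs_infty_gt.
have m0R : 0 < m%:R :> R by rewrite ltr0n.
have xm : 0 < x + m.+1%:R.
  rewrite -natr1; suff : - x < m%:R by lra.
  by near: m; exact: nbhs_infty_gtr.
have e : 1 + (x + 1) / m%:R = (x + m.+1%:R) / m%:R.
  by rewrite -natr1; field; rewrite gt_eqF.
have ne : x + m.+1%:R != 0 by rewrite gt_eqF.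
rewrite e -[gauss x m](mulfK ne) gaussS //; field; rewrite nat1r ne gt_eqF.
Unshelve. all: by end_near. Qed.

Lemma gauss_cvg x : gauss x @ \oo --> rGamma x.
Proof.
suff [l cl] : exists l : R, gauss x @ \oo --> l.
  by rewrite /rGamma -/(gauss x) (cvg_lim _ cl).
have [n] : exists n : nat, - x <= n%:R.
  by exists (Num.trunc `|x|).+1; have := truncnS_gt `|x|; have := ler_norm (- x); rewrite normrN; lra.
elim: n x => [|n IH] x.
  by rewrite oppr_le0 => x0; exists (limn (gauss x)); exact: gauss_cvg_ge0.
rewrite -natr1 => h; have [|l cl] := IH (x + 1); first by lra.
by exists (x * l); exact: gauss_step_cvg.
Qed.

Lemma rGammaS x : rGamma x = x * rGamma (x + 1).
Proof.
have h := gauss_step_cvg (@gauss_cvg (x + 1)).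
by apply: (cvg_unique _ (@gauss_cvg x) h); exact: Rhausdorff.
Qed.

(** The terms are bounded below by x: the product (x+1)...(x+m) is at least m! (m+1)^x, by induction
    on m from (1+t)^x <= 1 + x t, a consequence of the concavity of ln. *)
Lemma rGamma_gt0_le1 x : 0 < x -> x <= 1 -> 0 < rGamma x.
Proof.
move=> x0 x1; apply: (lt_le_trans x0).
apply: (cvgr_to_ge (@gauss_cvg x)).
near=> m.
have m0 : (0 < m)%N by near: m; exact: nbhs_infty_gt.
have m0R : 0 < m%:R :> R by rewrite ltr0n.
have f0 : 0 < m`!%:R :> R by rewrite ltr0n fact_gt0.
rewrite /gauss ler_pdivlMr ?mulr_gt0 ?powR_gt0 //.
rewrite big_ord_recl /= addr0 ler_pM2l //.
apply: (@le_trans _ _ (m`!%:R * m.+1%:R `^ x)).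
  by rewrite ler_pM2l // ge0_ler_powR ?nnegrE ?ltW // ltr_nat.
elim: (m) => [|j IH]; first by rewrite big_ord0 fact0 mul1r powR1.
rewrite big_ord_recr /= factS natrM.
have j1 : 0 < j.+1%:R :> R by [].
have j2 : 0 < j.+2%:R :> R by [].
have jf : 0 < j`!%:R :> R by rewrite ltr0n fact_gt0.
rewrite (_ : j.+2%:R `^ x = j.+1%:R `^ x * (1 + j.+1%:R^-1) `^ x); last first.
  rewrite -powRM ?addr_ge0 ?invr_ge0 ?ltW //; congr (_ `^ _).
  by rewrite mulrDr mulfV ?gt_eqF // mulr1 natr1.
rewrite (_ : _ * _ * _ = (j`!%:R * j.+1%:R `^ x) * (j.+1%:R * (1 + j.+1%:R^-1) `^ x)); last by ring.
apply: ler_pM => //.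
rewrite /bump /= -ler_pdivlMl //.
rewrite (_ : _ * _ = 1 + x * j.+1%:R^-1); last by rewrite mulrDr mulVf ?gt_eqF //; ring.
set t := _^-1.
have t0 : 0 <= t by rewrite invr_ge0.
have xi : 0 <= x <= 1 by lra.
have t1 : 0 < 1 + t by lra.
have := @concave_ln _ (Itv01 (ltW x0) x1) (1 + t) 1 t1 ltr01.
rewrite !convRE /= ln1 mulr0 addr0 mulr1 /unstable.onem => h.
rewrite /powR gt_eqF // -ler_ln ?posrE ?expR_gt0 //; last by nra.
rewrite expRK; apply: (le_trans h); rewrite le_eqVlt; apply/orP; left.
by apply/eqP; congr ln; ring.
Unshelve. all: by end_near. Qed.

Lemma rGamma_gt0 x : 0 < x -> 0 < rGamma x.
Proof.
have [n] : exists n : nat, x <= n.+1%:R.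
  by exists (Num.trunc x); apply: ltW; exact: truncnS_gt.
elim: n x => [|n IH] x xn x0; first exact: rGamma_gt0_le1.
have [x1|x1] := leP x 1; first exact: rGamma_gt0_le1.
have : 0 < rGamma (x - 1).
  by apply: IH; [rewrite -natr1 in xn; lra|lra].
by rewrite rGammaS subrK pmulr_rgt0 // subr_gt0.
Qed.

Lemma rGammaN_nat (k : nat) : rGamma (- k%:R : R) = 0.
Proof.
elim: k => [|k IH]; first by rewrite oppr0 rGammaS mul0r.
by rewrite rGammaS -natr1 opprD subrK IH mulr0.
Qed.

(** Each use of the functional equation extracts one negative factor, and k of them lead to a
    positive argument. For k = 0 the upper bound is dropped, the sign being constant on ]0, +oo[. *)
Lemma rGamma_sign (k : nat) x :
  - k%:R < x -> (0 < k)%N ==> (x < 1 - k%:R) -> 0 < (-1) ^+ k * rGamma x.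
Proof.
elim: k x => [|k IH] x; first by rewrite oppr0 mul1r => x0 _; exact: rGamma_gt0.
rewrite -natr1 /= => xl xr; rewrite rGammaS exprS.
have := IH (x + 1) ltac:(lra) ltac:(by apply/implyP => _; lra).
rewrite mulrACA => h; apply: mulr_gt0 => //.
have : 0 <= k%:R :> R by []. lra.
Qed.

End Gamma.

(** * Polynomial approximations with positive roots *)

Section Roots.
Variable R : realType.
Implicit Types (p : {poly R}) (rho b d : R).

(** Diagonal on monomials, with eigenvalue rho n + b on X^n; iterates with b, b + 1, ... therefore
    build the products that occur in [gauss]. *)
Definition eulerT rho b p : {poly R} := rho *: ('X * p^`()) + b *: p.

Lemma eulerT_horner rho b p y :
  (eulerT rho b p).[y] = rho * (y * p^`().[y]) + b * p.[y].
Proof. by rewrite /eulerT !hornerE. Qed.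

Lemma eulerTZ rho b p s : eulerT rho b (s *: p) = s *: eulerT rho b p.
Proof.
by rewrite /eulerT derivZ scalerDr -scalerAr !scalerA mulrC [b * s]mulrC.
Qed.

(* The derivative of y^(b/rho) p(y) is y^(b/rho - 1)/rho times eulerT rho b p. *)
Lemma eulerT_MVT rho b p (a c : R) : rho != 0 -> 0 < a -> a < c ->
  exists2 y, a < y < c & c `^ (b / rho) * p.[c] - a `^ (b / rho) * p.[a] =
    (y `^ (b / rho - 1) / rho * (eulerT rho b p).[y]) * (c - a).
Proof.
move=> rho0 a0 ac.
pose e := b / rho.
pose F := fun y : R => y `^ e * p.[y].
pose dF := fun y : R => y `^ (e - 1) / rho * (eulerT rho b p).[y].
have dFE (x : R) : 0 < x -> is_derive x 1 F (dF x).
  move=> x0; rewrite /F /dF.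
  apply: (is_derive_eq (is_deriveM (is_derive1_powR e x0) (is_derive_poly p x))).
  rewrite eulerT_horner /GRing.scale /=.
  have -> : x `^ e = x `^ (e - 1) * x.
    by rewrite -[in LHS](subrK 1 e) powRD ?(gt_eqF x0) ?implybT // powRr1 ?ltW.
  by rewrite /e; field.
have [||y yac e0] := @MVT R F dF a c ac.
- by move=> x /[!in_itv] /= /andP[ax _]; apply: dFE; exact: lt_trans ax.
- apply: derivable_within_continuous => x /[!in_itv] /= /andP[ax _].
  by have [? _] := dFE x (lt_le_trans a0 ax).
by exists y; [rewrite in_itv in yac|exact: e0].
Qed.

(** The function y^(b/rho) p(y) is smaller at c than at a. The inequality at c is not strict so that
    c may be the right end d, where p vanishes. *)
Lemma eulerT_sign_after rho b p (a c : R) : 0 < rho -> 0 < a -> a < c ->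
  0 < p.[a] -> p.[c] <= 0 -> exists2 y, a < y < c & (eulerT rho b p).[y] < 0.
Proof.
move=> rho0 a0 ac pa pc.
have [y yac e] := eulerT_MVT b p (lt0r_neq0 rho0) a0 ac.
exists y => //; have y0 : 0 < y by case/andP: yac => + _; apply: lt_trans.
have w0 : 0 < y `^ (b / rho - 1) / rho by rewrite divr_gt0 ?powR_gt0.
have : c `^ (b / rho) * p.[c] - a `^ (b / rho) * p.[a] < 0.
  rewrite subr_lt0; apply: (@le_lt_trans _ _ 0); last by rewrite mulr_gt0 ?powR_gt0.
  by rewrite mulr_ge0_le0 ?powR_ge0.
by rewrite e pmulr_llt0 ?subr_gt0 // pmulr_rlt0.
Qed.

(** For b > 0 the function y^(b/rho) p(y) tends to 0 at 0+, so it increases somewhere before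
    reaching its positive value at c. This is the source of the additional alternation. *)
Lemma eulerT_sign_before rho b p (c : R) : 0 < rho -> 0 < b -> 0 < c ->
  0 < p.[c] -> exists2 y, 0 < y < c & 0 < (eulerT rho b p).[y].
Proof.
move=> rho0 b0 c0 pc.
have Fc : 0 < c `^ (b / rho) * p.[c] by rewrite mulr_gt0 ?powR_gt0.
have F0 : (fun y : R => y `^ (b / rho) * p.[y]) @ 0^'+ --> 0 * p.[0].
  apply: cvgM; first by apply: powR_cvg0; rewrite divr_gt0.
  by apply: cvg_at_right_filter; exact: continuous_horner.
rewrite mul0r in F0.
have [a [a0 ac Fa]] : exists a, [/\ 0 < a, a < c &
    a `^ (b / rho) * p.[a] < c `^ (b / rho) * p.[c]].
  near (0 : R)^'+ => a; exists a; split; near: a.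
  - exact: nbhs_right_gt.
  - exact: nbhs_right_lt.
  - exact: (cvgr_lt _ F0).
have [y /andP[ay yc] e] := eulerT_MVT b p (lt0r_neq0 rho0) a0 ac.
have y0 : 0 < y by apply: lt_trans ay.
exists y; first by rewrite y0.
move: Fa; rewrite -subr_gt0 e pmulr_lgt0 ?subr_gt0 // pmulr_rgt0 //.
by rewrite divr_gt0 ?powR_gt0.
Unshelve. all: by end_near. Qed.

(** The k + 1 sample points witness k sign changes; [s], of either sign, fixes the sign at the first
    point. *)
Definition alternates p d (k : nat) := exists (s : R) (y : nat -> R),
  [/\ forall i, (i <= k)%N -> 0 < y i < d,
      forall i, (i < k)%N -> y i < y i.+1 &
      forall i, (i <= k)%N -> 0 < s * (-1) ^+ i * p.[y i]].

Lemma eulerT_alternates_aux rho b p d k (s : R) (y : nat -> R) :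
  0 < rho -> p.[d] = 0 ->
  (forall i, (i <= k)%N -> 0 < y i < d) ->
  (forall i, (i < k)%N -> y i < y i.+1) ->
  (forall i, (i <= k)%N -> 0 < s * (-1) ^+ i * p.[y i]) ->
  exists z : nat -> R,
    [/\ forall i, (i <= k)%N -> y i < z i < d,
        forall i, (i < k)%N -> z i < y i.+1 &
        forall i, (i <= k)%N -> s * (-1) ^+ i * (eulerT rho b p).[z i] < 0].
Proof.
move=> rho0 pd yd yi ys.
(* The last sample point also gets a successor, namely d, where p is zero. *)
pose Y i := if (i <= k)%N then y i else d.
have H i : exists z, (i <= k)%N ->
    y i < z < Y i.+1 /\ s * (-1) ^+ i * (eulerT rho b p).[z] < 0.
  have [ik|ik] := leqP i k; last by exists 0.
  have [||||z zi zs] := @eulerT_sign_after rho b ((s * (-1) ^+ i) *: p) (y i) (Y i.+1) rho0.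
  - by case/andP: (yd i ik).
  - by rewrite /Y; case: ifP => [/yi //|_]; case/andP: (yd i ik).
  - by rewrite hornerZ ys.
  - rewrite hornerZ /Y; case: ifP => [|_]; last by rewrite pd mulr0.
    by move=> /ys; rewrite exprS mulN1r mulrN mulNr oppr_gt0 => /ltW.
  by exists z => _; move: zs; rewrite eulerTZ hornerZ.
have [z Hz] := choice H.
exists z; split=> i ik.
  have [/andP[-> zY] _] := Hz i ik; apply: (lt_le_trans zY).
  by rewrite /Y; case: ifP => // /yd /andP[_ /ltW].
- have [/andP[_ +] _] := Hz i (ltnW ik); by rewrite /Y ik.
- by have [] := Hz i ik.
Qed.

Lemma eulerT_alternates rho b p d k : 0 < rho -> p.[d] = 0 ->
  alternates p d k -> alternates (eulerT rho b p) d k.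
Proof.
move=> rho0 pd [s [y [yd yi ys]]].
have [z [zd zi zs]] := eulerT_alternates_aux b rho0 pd yd yi ys.
exists (- s), z; split=> i ik.
- case/andP: (zd i ik) => yz ->; rewrite andbT (lt_trans _ yz) //.
  by case/andP: (yd i ik).
- by apply: lt_trans (zi _ ik) _; case/andP: (zd i.+1 ik).
- by rewrite !mulNr oppr_gt0 zs.
Qed.

(** The points z_i found to the right of the y_i carry the opposite sign; a point found before y_0
    keeps the sign at y_0 and is put in front. *)
Lemma eulerT_alternatesS rho b p d k : 0 < rho -> 0 < b -> p.[d] = 0 ->
  alternates p d k -> alternates (eulerT rho b p) d k.+1.
Proof.
move=> rho0 b0 pd [s [y [yd yi ys]]].
have [z [zd zi zs]] := eulerT_alternates_aux b rho0 pd yd yi ys.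
have [y00 y0d] := andP (yd 0 isT).
have [x /andP[x0 xy] xs] : exists2 x, 0 < x < y 0 & 0 < s * (eulerT rho b p).[x].
  have := ys 0 isT; rewrite expr0 mulr1 -hornerZ => h0.
  by have [x ? h] := eulerT_sign_before rho0 b0 y00 h0; exists x => //; rewrite -hornerZ -eulerTZ.
exists s, (fun i => if i is j.+1 then z j else x); split=> -[|i] ik.
- by rewrite x0 (lt_trans xy).
- case/andP: (zd i ik) => yz ->; rewrite andbT (lt_trans _ yz) //.
  by case/andP: (yd i ik).
- by apply: lt_trans xy _; case/andP: (zd 0 isT).
- by apply: lt_trans (zi _ ik) _; case/andP: (zd i.+1 ik).
- by rewrite mulr1.
- by rewrite exprS mulN1r mulrN mulNr oppr_gt0 zs.
Qed.

Lemma alternates_roots p d k : alternates p d k ->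
  exists xs : seq R, [/\ uniq xs, size xs = k & forall x, x \in xs -> 0 < x /\ root p x].
Proof.
move=> [s [y [yd yi ys]]].
have H i : exists x, (i < k)%N -> y i < x < y i.+1 /\ root p x.
  have [ik|ik] := leqP k i; first by exists 0.
  have h1 := ys i (ltnW ik); have h2 := ys _ ik.
  have [||x xi] := @poly_ivt R ((s * (-1) ^+ i.+1) *: p) (y i) (y i.+1).
  - exact/ltW/yi.
  - rewrite !hornerZ; apply/andP; split; last exact: ltW.
    by rewrite exprS mulN1r mulrN mulNr oppr_le0 ltW.
  have s0 : s * (-1) ^+ i.+1 != 0.
    by apply: contraTneq h2 => ->; rewrite mul0r ltxx.
  rewrite rootZ // => rx; exists x => _; split=> //.
  move: xi; rewrite !lt_neqAle => /andP[-> ->]; rewrite !andbT; apply/andP; split.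
    by apply: contraTneq h1 => ->; rewrite (rootP rx) mulr0 ltxx.
  by apply: contraTneq h2 => <-; rewrite (rootP rx) mulr0 ltxx.
have [x Hx] := choice H.
have x_incr i j : (i < j)%N -> (j < k)%N -> x i < x j.
  move=> ij; elim: j ij => // j IH; rewrite ltnS leq_eqVlt => /orP[/eqP ->|ij] jk.
    have [/andP[_ h] _] := Hx j (ltnW jk); have [/andP[h' _] _] := Hx _ jk.
    exact: lt_trans h'.
  apply: lt_trans (IH ij (ltnW jk)) _.
  have [/andP[_ h] _] := Hx j (ltnW jk); have [/andP[h' _] _] := Hx _ jk.
  exact: lt_trans h'.
exists [seq x i | i <- iota 0 k]; split.
- rewrite map_inj_in_uniq ?iota_uniq // => i j; rewrite !mem_iota !add0n /= => ik jk.
  by case: (ltngtP i j) => // h e; have := x_incr _ _ h; rewrite e ltxx => /(_ ltac:(done)).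
- by rewrite size_map size_iota.
move=> _ /mapP[i + ->]; rewrite mem_iota add0n /= => ik.
have [/andP[h _] ->] := Hx i ik; split=> //; apply: lt_trans h.
by case/andP: (yd i (ltnW ik)).
Qed.

(** The start (1 - X/D)^D approximates exp(-x). Its root D has multiplicity D, enough for D to
    remain a root until D operators have been applied. *)
Fixpoint eulerT_iter rho b (D j : nat) : {poly R} :=
  if j is i.+1 then eulerT rho (b + i%:R) (eulerT_iter rho b D i)
  else (1 - D%:R^-1 *: 'X) ^+ D.

Lemma coef_eulerT rho b p n : (eulerT rho b p)`_n = (rho * n%:R + b) * p`_n.
Proof.
rewrite /eulerT coefD !coefZ coefXM mulrDl; congr (_ + _).
case: n => [|n]; first by rewrite mulr0 !mul0r.
by rewrite coef_deriv -mulrA mulr_natl.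
Qed.

Lemma coef_eulerT_iter rho b D j n : (eulerT_iter rho b D j)`_n =
  \prod_(k < j) (rho * n%:R + b + k%:R) * ((- D%:R^-1) ^+ n *+ 'C(D, n)).
Proof.
elim: j => [|j IH] /=; last by rewrite coef_eulerT IH big_ord_recr /= addrA; ring.
rewrite big_ord0 mul1r -scaleNr exprDn coef_sum.
under eq_bigr => i _ do rewrite expr1n mul1r exprZn coefMn coefZ coefXn.
have [nD|nD] := ltnP n D.+1; last first.
  rewrite bin_small // mulr0n big1 // => i _.
  by rewrite (gtn_eqF (leq_trans (ltn_ord i) nD)) mulr0 mul0rn.
rewrite (bigD1 (Ordinal nD)) //= eqxx mulr1.
rewrite big1 ?addr0 // => i; rewrite -val_eqE /= eq_sym => /negPf ->.
by rewrite mulr0 mul0rn.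
Qed.

Lemma eulerT_iter_root rho b D j : (j < D)%N -> (eulerT_iter rho b D j).[D%:R] = 0.
Proof.
(* Each operator costs at most one factor 1 - X/D. *)
move=> jD; suff [q ->] : exists q, eulerT_iter rho b D j = q * (1 - D%:R^-1 *: 'X) ^+ (D - j).
  have D0 : D%:R != 0 :> R by rewrite pnatr_eq0; case: (D) jD.
  by rewrite !hornerE mulVf // subrr expr0n subn_eq0 leqNgt jD mulr0.
elim: j jD => [|j IH] jD; first by exists 1; rewrite mul1r subn0.
have [q /= ->] := IH (ltnW jD).
have -> : (D - j = (D - j.+1).+1)%N by lia.
move: (1 - _) (D - j.+1)%N => l m.
exists (rho *: ('X * (q^`() * l + q * (l^`() *+ m.+1))) + (b + j%:R) *: (q * l)).
rewrite /eulerT derivM deriv_exp /= exprS mulrDl -!scalerAl.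
congr (_ *: _ + _ *: _); last by rewrite mulrA.
rewrite -mulrA; congr ('X * _); rewrite mulrDl; congr (_ + _); first by rewrite mulrA.
by rewrite -mulrA mulrnAl.
Qed.


(** The first N operators, whose parameters may be negative, preserve alternations; the later ones
    have parameters b + i > 0 and add one each. Initially D/2 is the only sample point. *)
Lemma eulerT_iter_alternates rho b (N D j : nat) : 0 < rho -> 0 < b + N%:R ->
  (N <= j <= D)%N -> (0 < D)%N ->
  alternates (eulerT_iter rho b D j) D%:R (j - N).
Proof.
move=> rho0 bN /andP[Nj jD] D0; have D0R : 0 < D%:R :> R by rewrite ltr0n.
have base i : (i <= D)%N -> alternates (eulerT_iter rho b D i) D%:R 0.
  elim: i => [_|i IH iD] /=; last first.
    by apply: eulerT_alternates => //; [exact: eulerT_iter_root|exact/IH/ltnW].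
  exists 1, (fun=> D%:R / 2); split=> // i ik; first by apply/andP; split; lra.
  move: ik; rewrite leqn0 => /eqP ->.
  rewrite expr0 !mul1r horner_exp hornerD hornerN hornerZ hornerX hornerC.
  by rewrite exprn_gt0 // mulrA mulVf ?lt0r_neq0 // subr_gt0; lra.
rewrite -[in eulerT_iter _ _ _ _](subnKC Nj).
have : (N + (j - N) <= D)%N by rewrite subnKC.
elim: (j - N)%N => [|i IH]; first by rewrite addn0; exact: base.
rewrite addnS => iD /=; apply: eulerT_alternatesS => //.
- by rewrite natrD addrA ltr_wpDr.
- exact: eulerT_iter_root.
- exact/IH/ltnW.
Qed.

Definition gauss_poly rho b (m : nat) : {poly R} :=
  \poly_(n < m.+2) (gauss (rho * n%:R + b) m *
    ((- m.+1%:R^-1) ^+ n *+ 'C(m.+1, n))).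

Lemma coef_gauss_poly rho b m n : (gauss_poly rho b m)`_n =
  gauss (rho * n%:R + b) m * ((- m.+1%:R^-1) ^+ n *+ 'C(m.+1, n)).
Proof.
rewrite coef_poly; case: ltnP => // nm.
by rewrite bin_small // mulr0n mulr0.
Qed.

(** The substitution of m^(-rho) x for x supplies the factors m^(rho n) in the denominators of
    Gauss's quotients; m! and m^b are common to all coefficients. *)
Lemma gauss_poly_horner rho b m x : (0 < m)%N ->
  (gauss_poly rho b m).[x] =
  (eulerT_iter rho b m.+1 m.+1).[m%:R `^ (- rho) * x] / (m`!%:R * m%:R `^ b).
Proof.
move=> m0; have m0R : 0 < m%:R :> R by rewrite ltr0n.
rewrite (horner_coef_wide x (size_poly _ _)).
rewrite (@horner_coef_wide _ m.+2); last first.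
  apply/leq_sizeP => j mj.
  by rewrite coef_eulerT_iter bin_small // mulr0n mulr0.
rewrite mulr_suml; apply: eq_bigr => i _.
rewrite coef_gauss_poly coef_eulerT_iter /gauss.
rewrite powRD ?(gt_eqF m0R) ?implybT // powRN powRrM powR_mulrn ?powR_ge0 //.
rewrite exprMn exprVn; field.
by rewrite expf_neq0 ?gt_eqF ?powR_gt0 // ltr0n fact_gt0.
Qed.

(** When nonzero, [gauss_poly] has degree at most m + 1, so at most N further roots remain. *)
Lemma gauss_poly_roots rho b (N m : nat) : 0 < rho -> 0 < b + N%:R ->
  (0 < m)%N -> (N <= m.+1)%N ->
  exists xs : seq R, [/\ uniq xs, size xs = (m.+1 - N)%N &
    forall x, x \in xs -> 0 < x /\ root (gauss_poly rho b m) x].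
Proof.
move=> rho0 bN m0 Nm.
have [xs [ux sx rx]] : exists xs : seq R, [/\ uniq xs, size xs = (m.+1 - N)%N &
    forall x, x \in xs -> 0 < x /\ root (eulerT_iter rho b m.+1 m.+1) x].
  by apply/alternates_roots/eulerT_iter_alternates => //; rewrite Nm leqnn.
have c0 : 0 < m%:R `^ rho :> R by rewrite powR_gt0 ?ltr0n.
exists [seq m%:R `^ rho * x | x <- xs]; split.
- by rewrite map_inj_uniq //; apply: mulfI; rewrite gt_eqF.
- by rewrite size_map.
move=> _ /mapP[x /rx[x0 rtx] ->]; split; first exact: mulr_gt0.
have e : m%:R `^ (- rho) * (m%:R `^ rho * x) = x by rewrite powRN mulKf // gt_eqF.
by rewrite rootE gauss_poly_horner // e (rootP rtx) mul0r.
Qed.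

End Roots.

(** * Limits of products along an ultrafilter *)

Section UltraLimit.
Variable R : realType.

Lemma ultra_cvg_bounded (U : set_system nat) (u : nat -> R) (K : R) :
  UltraFilter U -> (\forall m \near U, `|u m| <= K) -> exists l : R, u @ U --> l.
Proof.
move=> UU uK.
have [|l [_ cl]] := @segment_compact R (- K) K (u @ U) _.
  by apply: filterS uK => m; rewrite /= in_itv /= ler_norml.
(* A cluster point of an ultrafilter is a limit: otherwise the complement of some neighbourhood
   would belong to the filter. *)
exists l => N lN; have [//|UN] := in_ultra_setVsetC (u @^-1` N) UU.
have [x [/= xN Nx]] := cl (~` N) N UN lN.
by case: xN.
Qed.

Lemma cvg_sum_ord (T : Type) (F : set_system T) {FF : Filter F} (k : nat)
    (f : nat -> T -> R) (l : nat -> R) : (forall i, f i @ F --> l i) ->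
  (fun x => \sum_(i < k) f i x) @ F --> \sum_(i < k) l i.
Proof. by move=> fl; apply: (cvg_big add_continuous) => i _; exact: fl. Qed.

Lemma sum_geo_le2 (q : R) N : 0 <= q -> q <= 2^-1 -> \sum_(i < N) q ^+ i <= 2.
Proof.
move=> q0 q1; elim: N => [|N IH]; first by rewrite big_ord0.
rewrite big_ord_recl expr0; under eq_bigr => i _ do rewrite /= /bump /= exprS.
by rewrite -mulr_sumr; nra.
Qed.

Definition pos_prod (us : seq R) : {poly R} := \prod_(u <- us) (1 - u *: 'X).

Lemma coef_1BcXM (p : {poly R}) u n :
  ((1 - u *: 'X) * p)`_n = p`_n - u * (if n is k.+1 then p`_k else 0).
Proof.
by rewrite mulrBl mul1r coefB -scalerAl coefZ coefXM; case: n.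
Qed.

(** The coefficients are dominated by those of prod_u (1 + u X), whose value at t is at most exp(t
    sum_u u). *)
Lemma pos_prod_coef_le (us : seq R) (t : R) n : all (> 0) us -> 0 <= t ->
  `|(pos_prod us)`_n| * t ^+ n <= expR (t * \sum_(u <- us) u).
Proof.
move=> + t0; rewrite /pos_prod; elim: us n => [|u us IH] n /=.
  move=> _; rewrite !big_nil mulr0 expR0 coef1; case: n => [|n].
    by rewrite normr1 mulr1.
  by rewrite normr0 mul0r.
move=> /andP[u0 us0]; rewrite !big_cons coef_1BcXM mulrDr expRD.
set E := expR (t * \sum_(_ <- _) _) in IH *.
apply: (@le_trans _ _ ((1 + t * u) * E)); last first.
  by rewrite ler_wpM2r ?expR_ge0 // expR_ge1Dx.
rewrite mulrDl mul1r; apply: (le_trans (ler_wpM2r _ (ler_normB _ _))).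
  by rewrite exprn_ge0.
rewrite mulrDl lerD ?IH //; case: n => [|n].
  by rewrite mulr0 normr0 mul0r !mulr_ge0 ?expR_ge0 // ltW.
rewrite normrM (gtr0_norm u0) exprS.
rewrite [leLHS](_ : _ = t * u * (`|(\prod_(j <- us) (1 - j *: 'X))`_n| * t ^+ n)); last by ring.
by rewrite ler_wpM2l ?IH // mulr_ge0 // ltW.
Qed.

(** * Moduli of roots and sizes of coefficients *)

Lemma normc_ge0 (z : R[i]) : 0 <= normc z.
Proof. by case: z => a b; exact: sqrtr_ge0. Qed.

Lemma normc_0 : normc (0 : R[i]) = 0. Proof. exact: normc0. Qed.

Lemma normc_real (x : R) : normc x%:C%C = `|x|.
Proof. by rewrite /normc /= expr0n /= addr0 sqrtr_sqr. Qed.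

(** Over the complex numbers, a factor X - z with |z| >= r multiplies the modulus of the constant
    coefficient by |z|, and the bound on the others by at most |z| + 1 <= |z| (1 + 1/r). *)
Lemma complex_roots_coef_le (p : {poly R}) (r : R) (M n : nat) :
  0 < r -> (size p <= M.+1)%N ->
  (forall w : R[i], root (map_poly (real_complex R) p) w -> r <= normc w) ->
  `|p`_n| <= `|p`_0| * (1 + r^-1) ^+ M.
Proof.
move=> r0 sp rw; set P := map_poly _ p in rw.
have [p0|p0] := eqVneq p 0; first by rewrite p0 !coef0 normr0 mul0r.
have [zs Pz] := closed_field_poly_normal P.
have P0 : P != 0 by rewrite map_poly_eq0.
have lP : lead_coef P != 0 by rewrite lead_coef_eq0.
have rz : all (fun z => r <= normc z) zs.
  by apply/allP => z zz; apply: rw; rewrite Pz rootZ // root_prod_XsubC.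
have szs : (size zs <= M)%N.
  by rewrite -ltnS (leq_trans _ sp) // -(size_map_poly (real_complex R)) -/P Pz size_scale // size_prod_XsubC.
have H : normc P`_n <= normc P`_0 * (1 + r^-1) ^+ (size zs).
  rewrite {}Pz !coefZ !normcM -mulrA ler_wpM2l //.
    exact: normc_ge0.
  elim: zs n rz {szs} => [|z zs IH] n /=; first by rewrite !big_nil !coef1 mulr1; case: n => // n _; rewrite normc_0 normc_ge0.
  move=> /andP[rz rzs]; rewrite !big_cons !mulrBl !coefB !coefXM !coefCM /= sub0r.
  set q := \prod_(_ <- _) _ in IH *; set K := (1 + r^-1) ^+ _ in IH.
  have z0 : 0 < normc z by exact: lt_le_trans rz.
  have K0 : 0 <= K by rewrite exprn_ge0 // addr_ge0 // invr_ge0 ltW.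
  have q0 : 0 <= normc q`_0 * K by rewrite mulr_ge0 ?normc_ge0.
  apply: (le_trans (le_normcD _ _)); rewrite !normcN !normcM exprS -/K.
  have h1 : 1 <= normc z * r^-1 by rewrite ler_pdivlMr // mul1r.
  have h2 : normc (if n == 0%N then 0 else q`_n.-1) <= normc q`_0 * K.
    by case: n => [|n] /=; [rewrite normc_0|exact: IH].
  have h3 := IH n rzs.
  have h4 : normc z * normc q`_n <= normc z * (normc q`_0 * K) by rewrite ler_wpM2l ?normc_ge0.
  have h5 : normc q`_0 * K <= normc z * r^-1 * (normc q`_0 * K) by rewrite ler_peMl.
  apply: (le_trans (lerD h2 h4)); apply: (le_trans (lerD h5 (lexx _))).
  by rewrite le_eqVlt; apply/orP; left; apply/eqP; ring.
rewrite !coef_map /= in H.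
rewrite !normc_real in H; apply: (le_trans H); rewrite ler_wpM2l //.
by rewrite ler_weXn2l // lerDl invr_ge0 ltW.
Qed.

Lemma normc_sum (I : Type) (r : seq I) (F : I -> R[i]) :
  normc (\sum_(i <- r) F i) <= \sum_(i <- r) normc (F i).
Proof.
elim: r => [|i r IH]; first by rewrite !big_nil normc_0.
by rewrite !big_cons (le_trans (le_normcD _ _)) // lerD.
Qed.

Lemma normcX (z : R[i]) n : normc (z ^+ n) = normc z ^+ n.
Proof.
elim: n => [|n IH]; first by rewrite !expr0; exact: normc1.
by rewrite !exprS normcM IH.
Qed.

(** With q = |w| B <= 1/2, a root w gives |p_0| <= C (q + q^2 + ...) <= 2 C q. The constant is
    chosen so that a smaller |w| forces both q <= 1/2 and 2 C q < eta. *)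
Lemma root_lower_bound (p : {poly R}) (C B eta : R) (w : R[i]) :
  0 <= C -> 0 < B -> 0 < eta -> (forall n, `|p`_n| <= C * B ^+ n) ->
  eta <= `|p`_0| -> root (map_poly (real_complex R) p) w ->
  eta / (4 * C + 4 + 2 * eta) / B <= normc w.
Proof.
move=> C0 B0 eta0 pB p0 rw; rewrite leNgt; apply/negP.
rewrite ltr_pdivlMr // => wq.
have D0 : 0 < 4 * C + 4 + 2 * eta by lra.
set q := normc w * B in wq.
have q0 : 0 <= q by rewrite mulr_ge0 ?normc_ge0 // ltW.
move: wq; rewrite ltr_pdivlMr // => wq.
have qC : 0 <= q * C by rewrite mulr_ge0.
have qe : 0 <= q * eta by rewrite mulr_ge0 // ltW.
have q2 : q <= 2^-1.
  rewrite leNgt; apply/negP => q2.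
  have h : 2^-1 * eta < q * eta by rewrite ltr_pM2r.
  lra.
have pn0 : p != 0 by apply: contraTneq p0 => ->; rewrite coef0 normr0 -ltNge.
have : normc (p`_0)%:C%C <= C * q * 2.
  have -> : (p`_0)%:C%C = - \sum_(i < (size p).-1) (p`_i.+1)%:C%C * w ^+ i.+1.
    apply/eqP; rewrite -addr_eq0; move/rootP/eqP: rw; rewrite horner_coef size_map_poly.
    rewrite -[size p]prednK ?size_poly_gt0 // big_ord_recl /= coef_map /= expr0 mulr1.
    by under eq_bigr => i _ do rewrite /bump /= add1n coef_map /=.
  rewrite normcN; apply: (le_trans (normc_sum _ _)).
  apply: (@le_trans _ _ (\sum_(i < (size p).-1) C * q * q ^+ i)).
    apply: ler_sum => i _; rewrite normcM normc_real normcX -mulrA -exprS /q exprMn.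
    by rewrite [normc w ^+ _ * _]mulrC mulrA ler_wpM2r ?exprn_ge0 ?normc_ge0.
  by rewrite -mulr_sumr ler_wpM2l ?sum_geo_le2 // mulr_ge0.
rewrite normc_real; lra.
Qed.

(** The roots of [W m] are roots of [P m], hence stay away from 0, which bounds the coefficients of
    [W m], of degree at most M. The coefficients of degree 1 then bound the sums of [us m].
    Everything bounded converges along one ultrafilter, and Cauchy products pass to the limit. *)
Lemma ultra_factor (P W : nat -> {poly R}) (us : nat -> seq R) (a : nat -> R)
    (M : nat) (C B : R) :
  0 < B -> (forall m, P m = pos_prod (us m) * W m) ->
  (forall m, all (> 0) (us m)) -> (forall m, (size (W m) <= M.+1)%N) ->
  (forall m n, `|(P m)`_n| <= C * B ^+ n) ->
  (forall n, (P m)`_n @[m --> \oo] --> a n) -> a 0%N != 0 ->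
  exists (F : set_system nat) (S : R) (h : nat -> R) (Q : {poly R}),
   [/\ ProperFilter F, \forall m \near F, \sum_(u <- us m) u <= S,
       forall n, (pos_prod (us m))`_n @[m --> F] --> h n &
   [/\ (size Q <= M.+1)%N, Q`_0 != 0 &
       forall n, a n = \sum_(i < n.+1) Q`_i * h (n - i)%N]].
Proof.
move=> B0 PE us0 sW PB Pa a0.
have C0 : 0 <= C by have := PB 0 0; rewrite mulr1; exact: le_trans.
have [U [UU oU]] := @ultraFilterLemma nat \oo _.
have Pa' n : (P m)`_n @[m --> U] --> a n.
  by apply: cvg_trans (Pa n); exact: cvg_app.
pose eta := `|a 0%N| / 2.
have eta0 : 0 < eta by rewrite divr_gt0 // normr_gt0.
have Peta : \forall m \near U, eta <= `|(P m)`_0|.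
  have : `|(P m)`_0| @[m --> U] --> `|a 0%N| by apply: cvg_norm.
  move=> /cvgr_ge; apply; rewrite /eta ltr_pdivrMr //.
  by rewrite ltr_pMr ?normr_gt0 // ltr1n.
have pp0 vs : (pos_prod vs)`_0 = 1.
  rewrite /pos_prod; elim: vs => [|v vs IH]; first by rewrite big_nil coef1.
  by rewrite big_cons coef_1BcXM mulr0 subr0.
have pp1 vs : (pos_prod vs)`_1 = - \sum_(v <- vs) v.
  elim: vs => [|v vs IH]; first by rewrite /pos_prod !big_nil coef1 oppr0.
  by rewrite /pos_prod !big_cons coef_1BcXM IH -/(pos_prod vs) pp0 mulr1 opprD addrC.
have PW0 m : (P m)`_0 = (W m)`_0 by rewrite PE coefM big_ord1 pp0 mul1r.
pose r := eta / (4 * C + 4 + 2 * eta) / B.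
have D0 : 0 < 4 * C + 4 + 2 * eta by lra.
have r0 : 0 < r by apply: divr_gt0 => //; apply: divr_gt0.
pose K := C * (1 + r^-1) ^+ M.
have WK : \forall m \near U, forall n, `|(W m)`_n| <= K.
  apply: filterS Peta => m Pm n.
  have rW w : root (map_poly (real_complex R) (W m)) w -> r <= normc w.
    move=> rw; apply: (@root_lower_bound (P m)) => //.
    by rewrite PE rmorphM rootM rw orbT.
  apply: (le_trans (complex_roots_coef_le n r0 (sW m) rW)).
  rewrite -PW0 ler_wpM2r //; first by rewrite exprn_ge0 // addr_ge0 // invr_ge0 ltW.
  by have := PB m 0%N; rewrite mulr1.
pose S := (C * B + K) / eta.
have SS : \forall m \near U, \sum_(u <- us m) u <= S.
  near=> m.
  have h0 : eta <= `|(P m)`_0| by near: m.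
  have h1 : `|(W m)`_1| <= K by near: m; apply: filterS WK => m; exact.
  have h2 := PB m 1%N; rewrite expr1 in h2.
  have s0 : 0 <= \sum_(u <- us m) u.
    by rewrite big_seq sumr_ge0 // => u /(allP (us0 m)) /ltW.
  rewrite /S ler_pdivlMr // (le_trans (ler_wpM2l s0 h0)) //.
  rewrite -(ger0_norm s0) -normrM.
  (* As [pos_prod] starts with 1 - (sum u) X, comparison in degree 1 gives P_1 = W_1 - (sum u)
     P_0. *)
  have -> : (\sum_(u <- us m) u) * (P m)`_0 = (W m)`_1 - (P m)`_1.
    rewrite [in (P m)`_1]PE coefM !big_ord_recl big_ord0 /= /bump /= pp0 pp1 PW0.
    by rewrite subn0 subnn; ring.
  by rewrite (le_trans (ler_normB _ _)) // addrC lerD.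
have hE n : exists l : R, (pos_prod (us m))`_n @[m --> U] --> l.
  apply: (@ultra_cvg_bounded U _ (expR S)) => //.
  apply: filterS SS => m Sm; have := pos_prod_coef_le n (us0 m) ler01.
  by rewrite expr1n mulr1 mul1r => /le_trans; apply; rewrite ler_expR.
have [h hP] := choice hE.
have wE n : exists l : R, (W m)`_n @[m --> U] --> l.
  by apply: (@ultra_cvg_bounded U _ K) => //; apply: filterS WK => m; exact.
have [w wP] := choice wE.
pose Q := \poly_(i < M.+1) w i.
have QP n : (W m)`_n @[m --> U] --> Q`_n.
  rewrite coef_poly; case: ltnP => // nM.
  rewrite (_ : (fun m => _) = fun=> 0); first exact: cvg_cst.
  by apply/funext => m; rewrite nth_default // (leq_trans (sW m)).
have aE n : a n = \sum_(i < n.+1) Q`_i * h (n - i)%N.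
  apply: (cvg_unique _ (Pa' n)); first exact: Rhausdorff.
  rewrite (_ : (fun m => (P m)`_n) =
    fun m => \sum_(i < n.+1) (W m)`_i * (pos_prod (us m))`_(n - i)); last first.
    by apply/funext => m; rewrite PE mulrC coefM.
  have Hi i : (W m)`_i * (pos_prod (us m))`_(n - i) @[m --> U] --> Q`_i * h (n - i)%N.
    by apply: cvgM; [exact: QP|exact: hP].
  exact: cvg_sum_ord Hi.
exists U, S, h, Q; split=> //; first exact: ultra_proper.
split=> //; first exact: size_poly.
by apply: contraNneq a0 => Q0; rewrite aE big_ord1 Q0 mul0r.
Unshelve. all: by end_near. Qed.

End UltraLimit.

(** * Entire power series over the complex numbers *)

Section ComplexSeries.
Variable R : realType.
Local Notation C := (Cplx R).
Implicit Types (z w : C) (a : nat -> C).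

Lemma ltc0_real (e : C) : 0 < e -> exists2 r : R, 0 < r & e = r%:C%C.
Proof.
by case: e => r i; rewrite ltcE /= => /andP[/eqP -> r0]; exists r.
Qed.

Lemma normC_normc z : `|z| = (normc z)%:C%C.
Proof. by []. Qed.

Lemma normc_le_ReIm (x y : R) : normc (x +i* y)%C <= `|x| + `|y|.
Proof.
rewrite /normc -[leRHS]ger0_norm ?addr_ge0 // -sqrtr_sqr ler_wsqrtr //.
rewrite sqrrD !real_normK ?num_real // addrAC lerDl mulrn_wge0 ?mulr_ge0 //.
Qed.

Lemma Im_le_normc z : `|complex.Im z| <= normc z.
Proof. by case: z => x y; rewrite /normc -sqrtr_sqr ler_wsqrtr //= lerDr sqr_ge0. Qed.

Lemma cvg_normcP (T : Type) (F : set_system T) {FF : Filter F}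
    (u : T -> C) (l : C) :
  (u @ F --> l) <-> (forall e : R, 0 < e -> \forall x \near F, normc (l - u x) <= e).
Proof.
split=> [/cvgrPdist_le ul e e0|ul].
  have := ul e%:C%C; rewrite ltcR => /(_ e0); apply: filterS => x.
  by rewrite normC_normc lecR.
apply/cvgrPdist_le => _ /ltc0_real[e e0 ->].
by apply: filterS (ul e e0) => x; rewrite normC_normc lecR.
Qed.

Lemma normc_lim_le (T : Type) (F : set_system T) (u : T -> C) (l : C) (B : R) :
  ProperFilter F -> u @ F --> l -> (\forall x \near F, normc (u x) <= B) ->
  normc l <= B.
Proof.
move=> FF ul uB; apply/ler_addgt0Pr => e e0.
move/cvg_normcP: ul => /(_ e e0) uE.
have [x [xB xE]] := @filter_ex _ _ FF _ (filterI uB uE).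
by rewrite -[l](subrK (u x)) (le_trans (le_normcD _ _)) // addrC lerD.
Qed.

(** An infinite radius of convergence, phrased by bounds: the one at 2t yields a geometric majorant
    of ratio 1/2 on the disc of radius t, by which all tails are estimated. *)
Definition entire a := forall t : R, 0 < t -> exists K, forall n, normc (a n) * t ^+ n <= K.

Definition psum a z (k : nat) : C := \sum_(i < k) a i * z ^+ i.

Definition pser a z : C := limn (psum a z).

Lemma sum_half_le (k l : nat) : \sum_(k <= i < l) 2^-1 ^+ i <= 2 * 2^-1 ^+ k :> R.
Proof.
have [kl|lk] := leqP k l; last by rewrite big_geq ?mulr_ge0 ?exprn_ge0 // ltnW.
rewrite -{1}[k]add0n big_addn big_mkord.
under eq_bigr => i _ do rewrite exprD.
by rewrite -mulr_suml ler_wpM2r ?exprn_ge0 // sum_geo_le2.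
Qed.

Lemma term_le a z (t K : R) n : normc z <= t -> normc (a n) * (2 * t) ^+ n <= K ->
  normc (a n * z ^+ n) <= K * 2^-1 ^+ n.
Proof.
move=> zt aK; rewrite normcM normcX.
have -> : normc (a n) * normc z ^+ n = normc (a n) * (2 * normc z) ^+ n * 2^-1 ^+ n.
  by rewrite -mulrA -exprMn mulrAC mulfV // mul1r.
rewrite ler_wpM2r ?exprn_ge0 // (le_trans _ aK) // ler_wpM2l ?normc_ge0 //.
have z0 := normc_ge0 z; have t0 := le_trans z0 zt.
by rewrite lerXn2r ?nnegrE ?mulr_ge0 // ler_wpM2l.
Qed.

Lemma psum_tail a z (t K : R) (k l : nat) : normc z <= t ->
  (forall n, normc (a n) * (2 * t) ^+ n <= K) -> (k <= l)%N ->
  normc (psum a z l - psum a z k) <= 2 * K * 2^-1 ^+ k.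
Proof.
move=> zt aK kl; rewrite /psum -!(big_mkord xpredT (fun i => a i * z ^+ i)).
rewrite (big_cat_nat _ kl) //= addrAC subrr add0r.
apply: (le_trans (normc_sum _ _)).
rewrite [2 * K]mulrC -mulrA.
have K0 : 0 <= K by apply: le_trans (aK 0%N); rewrite mulr1 normc_ge0.
apply: (@le_trans _ _ (K * \sum_(k <= i < l) 2^-1 ^+ i)); last first.
  by rewrite ler_wpM2l // sum_half_le.
by rewrite mulr_sumr; apply: ler_sum => i _; apply: (term_le zt).
Qed.

Lemma entire_cvg a z : entire a -> psum a z @ \oo --> pser a z.
Proof.
move=> ea; pose t := normc z + 1.
have t0 : 0 < t by rewrite ltr_wpDl ?normc_ge0.
have [K aK] := ea (2 * t) ltac:(by rewrite mulr_gt0).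
have zt : normc z <= t by rewrite lerDl.
(* Convergence is reduced to real series; f will be the real and the imaginary part, both additive
   and dominated by the modulus. *)
have cre (f : C -> R) : {morph f : x y / x + y} -> f 0 = 0 ->
    (forall x, `|f x| <= normc x) ->
    exists l : R, (fun k => f (psum a z k)) @ \oo --> l.
  move=> fD f0 fn.
  have -> : (fun k => f (psum a z k)) = series (fun i => f (a i * z ^+ i)).
    apply/funext => k.
    rewrite /psum /series /= big_mkord.
    by elim: k => [|k IH]; rewrite ?big_ord0 // !big_ord_recr /= fD IH.
  apply/cvg_ex; apply: normed_cvg; apply: (@series_le_cvg _ _ (geometric K 2^-1)) => [n|n|n|].
  - exact: normr_ge0.
  - by rewrite mulr_ge0 ?exprn_ge0 //; apply: le_trans (aK 0%N); rewrite mulr1 normc_ge0.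
  - by apply: (le_trans (fn _)); exact: (term_le zt).
  - by apply: is_cvg_geometric_series; rewrite gtr0_norm // invf_lt1 // ltr1n.
have [x cx] := cre (@complex.Re R) ltac:(by move=> [? ?] [? ?]) erefl
  ltac:(by move=> w; rewrite -lecR; exact: normc_ge_Re).
have [y cy] := cre (@complex.Im R) ltac:(by move=> [? ?] [? ?]) erefl
  Im_le_normc.
suff cl : psum a z @ \oo --> ((x +i* y)%C : C).
  by rewrite /pser (cvg_lim _ cl) //; exact: norm_hausdorff.
apply/cvg_normcP => e e0.
have e20 : 0 < e / 2 by rewrite divr_gt0.
move/cvgrPdist_le : cx => /(_ _ e20) cx; move/cvgrPdist_le : cy => /(_ _ e20) cy.
near=> k.
have hx : `|x - complex.Re (psum a z k)| <= e / 2 by near: k.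
have hy : `|y - complex.Im (psum a z k)| <= e / 2 by near: k.
case: (psum a z k) hx hy => u v /= hx hy.
have -> : (x +i* y - (u +i* v) = (x - u) +i* (y - v))%C by [].
by apply: (le_trans (normc_le_ReIm _ _)); lra.
Unshelve. all: by end_near. Qed.

Lemma pser_tail a z (t K : R) (k : nat) : entire a -> normc z <= t ->
  (forall n, normc (a n) * (2 * t) ^+ n <= K) ->
  normc (pser a z - psum a z k) <= 2 * K * 2^-1 ^+ k.
Proof.
move=> ea zt aK.
apply: (@normc_lim_le _ \oo (fun l => psum a z l - psum a z k)).
  by apply: cvgB; [exact: entire_cvg|exact: cvg_cst].
by near=> l; apply: (psum_tail zt aK); near: l; exact: nbhs_infty_ge.
Unshelve. all: by end_near. Qed.

Lemma pserE a z l : psum a z @ \oo --> l -> pser a z = l.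
Proof. by move=> h; rewrite /pser (cvg_lim _ h) //; exact: norm_hausdorff. Qed.

(* Coefficients of the derivative, respectively of the product by z - w, of the
   power series with coefficients a. *)
Definition dcoef a (n : nat) : C := n.+1%:R * a n.+1.

Definition mulXB w a (n : nat) : C := (if n is k.+1 then a k else 0) - w * a n.

Lemma normc_nat (n : nat) : normc (n%:R : C) = n%:R.
Proof.
by rewrite -[n%:R](rmorph_nat (real_complex R)) normc_real ger0_norm.
Qed.

Lemma entireD a b : entire a -> entire b -> entire (fun n => a n + b n).
Proof.
move=> ea eb t t0; have [K aK] := ea t t0; have [L bL] := eb t t0.
exists (K + L) => n; apply: le_trans (lerD (aK n) (bL n)).
by rewrite -mulrDl ler_wpM2r ?exprn_ge0 ?(ltW t0) // le_normcD.
Qed.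

Lemma entireZ c a : entire a -> entire (fun n => c * a n).
Proof.
move=> ea t t0; have [K aK] := ea t t0.
by exists (normc c * K) => n; rewrite normcM -mulrA ler_wpM2l ?normc_ge0.
Qed.

(** The factor n + 1 is absorbed by 2^(n+1) and t^n by (t+1)^(n+1), whence the radius 2 (t + 1). *)
Lemma entire_dcoef a : entire a -> entire (dcoef a).
Proof.
move=> ea t t0; have [K aK] := ea (2 * (t + 1)) ltac:(lra).
exists K => n; apply: le_trans (aK n.+1).
rewrite /dcoef normcM normc_nat [n.+1%:R * _]mulrC -mulrA ler_wpM2l ?normc_ge0 //.
rewrite exprMn ler_pM ?exprn_ge0 ?(ltW t0) //.
  by rewrite -natrX ler_nat ltnW // ltn_expl.
rewrite exprS; apply: (@le_trans _ _ ((t + 1) ^+ n)).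
  by rewrite lerXn2r ?nnegrE ?(ltW t0) //; lra.
by rewrite ler_peMl ?exprn_ge0 //; lra.
Qed.

Lemma entire_mulXB w a : entire a -> entire (mulXB w a).
Proof.
move=> ea; rewrite /mulXB.
have -> : (fun n => (if n is k.+1 then a k else 0) - w * a n) =
    (fun n => (if n is k.+1 then a k else 0) + (- w) * a n).
  by apply/funext => n; rewrite mulNr.
apply: entireD; last exact: entireZ.
move=> t t0; have [K aK] := ea t t0; exists (t * K) => -[|n].
  rewrite normc_0 mul0r mulr_ge0 ?(ltW t0) //.
  by apply: le_trans (aK 0%N); rewrite mulr1 normc_ge0.
by rewrite exprS mulrCA ler_wpM2l ?(ltW t0).
Qed.

Lemma pserD a b z : entire a -> entire b ->
  pser (fun n => a n + b n) z = pser a z + pser b z.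
Proof.
move=> ea eb; apply: pserE.
rewrite (_ : psum _ z = psum a z \+ psum b z); last first.
  by apply/funext => k; rewrite /psum /= -big_split /=; apply: eq_bigr => i _; rewrite mulrDl.
by apply: cvgD; exact: entire_cvg.
Qed.

Lemma pserZ c a z : entire a -> pser (fun n => c * a n) z = c * pser a z.
Proof.
move=> ea; apply: pserE.
rewrite (_ : psum _ z = fun k => c * psum a z k); last first.
  by apply/funext => k; rewrite /psum mulr_sumr; apply: eq_bigr => i _; rewrite mulrA.
by apply: cvgMr; exact: entire_cvg.
Qed.

Lemma pser_mulXB w a z : entire a -> pser (mulXB w a) z = (z - w) * pser a z.
Proof.
move=> ea; apply: pserE; rewrite -cvg_shiftS.
rewrite (_ : (fun n => _) = fun n => z * psum a z n - w * psum a z n.+1); last first.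
  apply/funext => k; rewrite /psum /mulXB.
  under eq_bigr => i _ do rewrite mulrBl.
  rewrite sumrB; congr (_ - _); last by rewrite mulr_sumr; apply: eq_bigr => i _; rewrite mulrA.
  rewrite big_ord_recl mul0r add0r mulr_sumr; apply: eq_bigr => i _.
  by rewrite /= /bump /= exprS mulrCA.
have h : psum a z @ \oo --> pser a z := entire_cvg ea.
have hS : (fun n => psum a z n.+1) @ \oo --> pser a z by rewrite cvg_shiftS.
rewrite mulrBl; apply: cvgB; first exact: cvgMr.
by apply: cvgMr.
Qed.

(** By induction: the remainder for n + 1 is (z + h) times that for n, plus h^2 n z^(n-1), where n
    <= 2^n. *)
Lemma expr_taylor_le z (h : C) (t : R) n : normc z + 1 <= t -> normc h <= 1 ->
  normc ((z + h) ^+ n - z ^+ n - h * (n%:R * z ^+ n.-1)) <= normc h ^+ 2 * (2 * t) ^+ n.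
Proof.
move=> zt h1; have t1 : 1 <= t by have := normc_ge0 z; lra.
have t0 : 0 <= t by lra.
elim: n => [|n IH].
  by rewrite !expr0 mul0r mulr0 subrr subr0 normc_0 mulr1 exprn_ge0 ?normc_ge0.
have -> : (z + h) ^+ n.+1 - z ^+ n.+1 - h * (n.+1%:R * z ^+ n) =
    (z + h) * ((z + h) ^+ n - z ^+ n - h * (n%:R * z ^+ n.-1)) +
    h ^+ 2 * (n%:R * z ^+ n.-1).
  by case: n {IH} => [|n] /=; rewrite ?exprS -?natr1; ring.
have zh : normc (z + h) <= t by apply: (le_trans (le_normcD _ _)); lra.
apply: (le_trans (le_normcD _ _)).
have h2 : normc (h ^+ 2 * (n%:R * z ^+ n.-1)) <= normc h ^+ 2 * (2 * t) ^+ n.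
  rewrite normcM normcX normcM normcX normc_nat.
  apply: ler_wpM2l; first by rewrite exprn_ge0 ?normc_ge0.
  rewrite exprMn.
  rewrite ler_pM ?exprn_ge0 ?normc_ge0 //; first by rewrite -natrX ler_nat ltnW // ltn_expl.
  apply: (@le_trans _ _ (t ^+ n.-1)).
    by rewrite lerXn2r ?nnegrE ?normc_ge0 //; lra.
  by rewrite ler_weXn2l // leq_pred.
have h3 : normc ((z + h) * ((z + h) ^+ n - z ^+ n - h * (n%:R * z ^+ n.-1))) <=
    t * (normc h ^+ 2 * (2 * t) ^+ n).
  by rewrite normcM ler_pM ?normc_ge0.
apply: (le_trans (lerD h3 h2)); rewrite [(2 * t) ^+ n.+1]exprS.
have : 0 <= normc h ^+ 2 * (2 * t) ^+ n by rewrite mulr_ge0 ?exprn_ge0 ?normc_ge0 //; lra.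
rewrite [_ * (2 * t * _)]mulrCA; nra.
Qed.

Lemma pser_taylor_le a z : entire a -> exists K : R, forall h : C, normc h <= 1 ->
  normc (pser a (z + h) - pser a z - h * pser (dcoef a) z) <= K * normc h ^+ 2.
Proof.
move=> ea; pose t := normc z + 1.
have t0 : 0 < t by rewrite ltr_wpDl ?normc_ge0.
(* One factor 2 comes from the bound (2t)^n on the remainder of z^n, the other makes the sum
   geometric. *)
have [K aK] := ea (2 * (2 * t)) ltac:(lra).
exists (2 * K) => h h1.
apply: (@normc_lim_le _ \oo (fun l => psum a (z + h) l.+1 - psum a z l.+1 - h * psum (dcoef a) z l)).
  have c1 x : (fun l => psum a x l.+1) @ \oo --> pser a x.
    by rewrite cvg_shiftS; exact: entire_cvg.
  apply: cvgB; first exact: cvgB.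
  by apply: cvgMr; apply: entire_cvg; exact: entire_dcoef.
near=> l.
have -> : psum a (z + h) l.+1 - psum a z l.+1 - h * psum (dcoef a) z l =
    \sum_(i < l.+1) a i * ((z + h) ^+ i - z ^+ i - h * (i%:R * z ^+ i.-1)).
  have -> : psum (dcoef a) z l = \sum_(i < l.+1) a i * (i%:R * z ^+ i.-1).
    rewrite big_ord_recl mul0r mulr0 add0r; apply: eq_bigr => i _.
    by rewrite /dcoef /= /bump /= mulrA [a _ * _]mulrC.
  rewrite /psum mulr_sumr -!sumrB; apply: eq_bigr => i _; ring.
apply: (le_trans (normc_sum _ _)).
apply: (@le_trans _ _ (\sum_(i < l.+1) (K * normc h ^+ 2) * 2^-1 ^+ i)).
  apply: ler_sum => i _; rewrite normcM.
  apply: (le_trans (ler_wpM2l (normc_ge0 _) (expr_taylor_le i (lexx t) h1))).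
  move: (normc h ^+ 2) (exprn_ge0 2 (normc_ge0 h)) => q q0.
  rewrite mulrCA [K * _]mulrC -mulrA ler_wpM2l //.
  apply: le_trans (ler_wpM2r _ (aK i)); last by rewrite exprn_ge0.
  by rewrite -mulrA -exprMn (_ : 2 * (2 * t) * 2^-1 = 2 * t) //; lra.
have K0 : 0 <= K by apply: le_trans (aK 0%N); rewrite mulr1 normc_ge0.
move: (normc h ^+ 2) (exprn_ge0 2 (normc_ge0 h)) => q q0.
rewrite -mulr_sumr [2 * K]mulrC -!mulrA ler_wpM2l // mulrC ler_wpM2r //.
exact: sum_geo_le2.
Unshelve. all: by end_near. Qed.

Lemma derive1_pser a : entire a -> derive1 (pser a) = pser (dcoef a).
Proof.
move=> ea; apply/funext => z; rewrite /derive1.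
suff h : (fun h : C => h^-1 *: (pser a (h + z) - pser a z)) @ 0^' --> pser (dcoef a) z.
  by rewrite (cvg_lim _ h) //; exact: norm_hausdorff.
have [K aK] := pser_taylor_le z ea.
apply/cvg_normcP => e e0.
have K1 : 0 < `|K| + 1 by rewrite ltr_wpDl.
near=> h.
have h0 : h != 0 by near: h; exact: nbhs_dnbhs_neq.
have hn : 0 < normc h by rewrite lt_neqAle normc_ge0 andbT eq_sym; apply: contra_neq h0; exact: eq0_normc.
have [h1 he] : normc h <= 1 /\ normc h <= e / (`|K| + 1).
  have : `|h| < (Num.min 1 (e / (`|K| + 1)))%:C%C.
    near: h; apply: dnbhs0_lt; rewrite ltcR lt_min ltr01 /=; exact: divr_gt0.
  by rewrite normC_normc ltcR lt_min => /andP[/ltW ? /ltW].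
have hr : pser (dcoef a) z - h^-1 *: (pser a (h + z) - pser a z) =
    - h^-1 * (pser a (z + h) - pser a z - h * pser (dcoef a) z).
  by rewrite [h + z]addrC mulNr mulrBr mulKf // opprB.
rewrite hr normcM normcN normcV mulrC ler_pdivrMr //.
apply: (le_trans (aK h h1)); rewrite expr2 mulrA ler_wpM2r ?(ltW hn) //.
apply: (@le_trans _ _ ((`|K| + 1) * normc h)).
  by rewrite ler_wpM2r ?(ltW hn) // (le_trans (ler_norm K)) // lerDl.
by rewrite mulrC -ler_pdivlMr.
Unshelve. all: by end_near. Qed.

Lemma derive1n_pser a n : entire a -> derive1n n (pser a) = pser (iter n dcoef a).
Proof.
move=> ea; suff [-> //] : derive1n n (pser a) = pser (iter n dcoef a) /\ entire (iter n dcoef a).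
elim: n => // n [IH en]; rewrite /derive1n iterS -/(derive1n n _) IH derive1_pser //.
by split=> //; exact: entire_dcoef.
Qed.

(** * Multiplicities of the zeros brought in by factors z - w *)

Lemma entire_iter_mulXB w a k : entire a -> entire (iter k (mulXB w) a).
Proof. by move=> ea; elim: k => // k IH; exact: entire_mulXB. Qed.

Lemma mulXBD w a b :
  mulXB w (fun n => a n + b n) = (fun n => mulXB w a n + mulXB w b n).
Proof.
by apply/funext => -[|n]; rewrite /mulXB mulrDr opprD ?addr0 ?add0r // addrACA.
Qed.

Lemma iter_mulXBD w a b k : iter k (mulXB w) (fun n => a n + b n) =
  (fun n => iter k (mulXB w) a n + iter k (mulXB w) b n).
Proof. by elim: k => // k IH; rewrite !iterS IH mulXBD. Qed.

Lemma dcoef_mulXB w a :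
  dcoef (mulXB w a) = (fun n => a n + mulXB w (dcoef a) n).
Proof.
apply/funext => n; rewrite /dcoef /mulXB mulrBr mulrCA addrA; congr (_ - _).
by case: n => [|n]; rewrite ?mul1r ?addr0 // -[n.+2%:R]nat1r mulrDl mul1r.
Qed.

(** Product rule for (z - w)^(k+1) f, with (z - w)^k factored out. *)
Lemma dcoef_iter_mulXB w a k : dcoef (iter k.+1 (mulXB w) a) =
  iter k (mulXB w) (fun n => k.+1%:R * a n + mulXB w (dcoef a) n).
Proof.
elim: k a => [|k IH] a.
  by rewrite /= dcoef_mulXB; apply/funext => n; rewrite mul1r.
rewrite iterS dcoef_mulXB IH [iter k.+1 _ _ in LHS]iterSr [RHS]iterSr.
have e x : mulXB w (iter k (mulXB w) x) = iter k (mulXB w) (mulXB w x).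
  by rewrite -iterS iterSr.
rewrite e -iter_mulXBD -mulXBD; congr (iter k _ (mulXB w _)).
by apply/funext => n; rewrite addrA -[k.+2%:R]nat1r mulrDl mul1r.
Qed.

(** Induction on k: the derivative of (z - w)^(k+1) f is (z - w)^k g with g(w) = (k + 1) f(w), again
    nonzero. *)
Lemma zero_order_iter_mulXB w a k : entire a -> pser a w <> 0 ->
  zero_order (pser (iter k (mulXB w) a)) w k.
Proof.
elim: k a => [|k IH] a ea aw; first by split.
pose b n := k.+1%:R * a n + mulXB w (dcoef a) n.
have eb : entire b.
  by apply: entireD; [exact: entireZ|apply/entire_mulXB/entire_dcoef].
have bw : pser b w <> 0.
  rewrite pserD; [|exact: entireZ|exact/entire_mulXB/entire_dcoef].
  rewrite pserZ // pser_mulXB; last exact: entire_dcoef.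
  by rewrite subrr mul0r addr0; apply/eqP; rewrite mulf_neq0 ?pnatr_eq0 //; exact/eqP.
have ek := entire_iter_mulXB w k.+1 ea.
have dE j : derive1n j.+1 (pser (iter k.+1 (mulXB w) a)) =
    derive1n j (pser (iter k (mulXB w) b)).
  rewrite derive1n_pser // derive1n_pser; last exact: entire_iter_mulXB.
  by rewrite iterSr dcoef_iter_mulXB.
have [IH1 IH2] := IH b eb bw; split; last by rewrite dE.
move=> [_|j jk]; last by rewrite dE; exact: IH1.
by rewrite /= pser_mulXB ?subrr ?mul0r //; exact: entire_iter_mulXB.
Qed.

(** Cauchy product of a polynomial and a power series. It turns iterated [mulXB] into multiplication
    by a polynomial, so that linear factors may be reordered. *)
Definition convp (p : {poly C}) a (n : nat) : C := \sum_(i < n.+1) p`_i * a (n - i)%N.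

Lemma convp1 a : convp 1 a = a.
Proof.
apply/funext => n; rewrite /convp big_ord_recl coef1 eqxx mul1r subn0.
by rewrite big1 ?addr0 // => i _; rewrite coef1 mul0r.
Qed.

Lemma convpZ c p a : convp (c *: p) a = (fun n => c * convp p a n).
Proof.
apply/funext => n; rewrite /convp mulr_sumr; apply: eq_bigr => i _.
by rewrite coefZ mulrA.
Qed.

Lemma convpXB w p a : convp (('X - w%:P) * p) a = mulXB w (convp p a).
Proof.
apply/funext => n; rewrite /convp /mulXB mulrBl.
under eq_bigr => i _ do rewrite coefB coefXM coefCM mulrBl.
rewrite sumrB; congr (_ - _); last by rewrite mulr_sumr; apply: eq_bigr => i _; rewrite mulrA.
rewrite big_ord_recl mul0r add0r; case: n => [|n]; first by rewrite big_ord0.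
by apply: eq_bigr => i _; rewrite /= /bump /= subSS.
Qed.

Lemma convp_prod (zs : seq C) p a :
  convp (\prod_(z <- zs) ('X - z%:P) * p) a = foldr mulXB (convp p a) zs.
Proof.
elim: zs => [|z zs IH]; first by rewrite big_nil mul1r.
by rewrite big_cons -mulrA convpXB IH.
Qed.

Lemma perm_foldr_mulXB a (s1 s2 : seq C) : perm_eq s1 s2 ->
  foldr mulXB a s1 = foldr mulXB a s2.
Proof. by move=> s12; rewrite -[a]convp1 -!convp_prod (perm_big _ s12). Qed.

Lemma entire_foldr zs a : entire a -> entire (foldr mulXB a zs).
Proof. by move=> ea; elim: zs => // z zs IH; exact: entire_mulXB. Qed.

Lemma pser_foldr zs a z : entire a ->
  pser (foldr mulXB a zs) z = \prod_(w <- zs) (z - w) * pser a z.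
Proof.
move=> ea; elim: zs => [|w zs IH]; first by rewrite big_nil mul1r.
by rewrite big_cons -mulrA -IH pser_mulXB //; exact: entire_foldr.
Qed.

Lemma nonpos_zero_count_prod (zs : seq C) a : entire a ->
  (forall z, z \in zs -> ~ 0 < z) -> (forall z, ~ 0 < z -> pser a z <> 0) ->
  nonpos_zero_count (pser (foldr mulXB a zs)) (size zs).
Proof.
move=> ea zs0 az; exists (undup zs), (fun z => count_mem z zs); split.
- exact: undup_uniq.
- move=> z; rewrite mem_undup pser_foldr //; split=> [zz|[/eqP]].
    by split; [rewrite (big_rem z) //= subrr !mul0r|exact: zs0].
  rewrite mulf_eq0 => /orP[/eqP h _|/eqP h /az //].
  suff : root (\prod_(w <- zs) ('X - w%:P)) z by rewrite root_prod_XsubC.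
  rewrite rootE horner_prod -[X in _ == X]h; apply/eqP/eq_bigr => w _.
  by rewrite !hornerE.
- move=> z; rewrite mem_undup => zz.
  have zz0 := zs0 z zz.
  (* The factors vanishing at z are moved to the front; neither the others nor the series [a] vanish
     at z. *)
  pose rest := [seq w <- zs | w != z].
  have -> : foldr mulXB a zs = iter (count_mem z zs) (mulXB z) (foldr mulXB a rest).
    rewrite (perm_foldr_mulXB a (s2 := nseq (count_mem z zs) z ++ rest)).
      by rewrite foldr_cat; elim: (count_mem z zs) => //= k ->.
    have /all_pred1P := filter_all (pred1 z) zs; rewrite size_filter => <-.
    by rewrite perm_sym; apply/permPl/perm_filterC.
  apply: zero_order_iter_mulXB; first exact: entire_foldr.
  rewrite pser_foldr //; apply/eqP; rewrite mulf_neq0 //; last exact/eqP/az.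
  rewrite prodf_seq_neq0; apply/allP => w; rewrite mem_filter => /andP[wz _].
  by rewrite /= subr_eq0 eq_sym.
rewrite -[RHS](perm_size (perm_count_undup zs)) size_flatten sumnE /shape -map_comp big_map.
by apply: eq_bigr => z _; rewrite /= size_nseq.
Qed.

End ComplexSeries.

(** * Zero-free regions of limits *)

Section Limits.
Variable R : realType.
Local Notation C := (Cplx R).
Implicit Types (z : C) (us : seq R).

Definition toC (a : nat -> R) (n : nat) : C := (a n)%:C%C.

(** For Re z <= 0 the modulus is at least 1 and K = 0 works. Otherwise z is not real, and since
    exp(-K u) <= 1/(1 + K u) it suffices that (1 + K u) |1 - u z|^2 >= 1. *)
Lemma factor_lower_bound z : ~ 0 < z -> exists K : R, forall u : R, 0 < u ->
  expR (- (K * u)) <= normc (1 - u%:C%C * z : C) ^+ 2.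
Proof.
case: z => x y zpos.
have nE u : normc (1 - u%:C%C * (x +i* y)%C : C) ^+ 2 = (1 - u * x) ^+ 2 + (u * y) ^+ 2.
  have -> : (1 - u%:C * (x +i* y) = (1 - (u * x - 0 * y)) +i* (0 - (u * y + 0 * x)))%C by [].
  rewrite /normc sqr_sqrtr ?addr_ge0 ?sqr_ge0 // !mul0r subr0 addr0 sub0r sqrrN //.
have [x0|x0] := leP x 0.
  exists 0 => u u0; rewrite mul0r oppr0 expR0 nE.
  have : u * x <= 0 by rewrite pmulr_rle0.
  have := sqr_ge0 (u * y); nra.
have y0 : y != 0.
  by apply/eqP => y0; apply: zpos; rewrite y0 ltcE /= eqxx.
have y2 : 0 < y ^+ 2 by rewrite exprn_even_gt0.
pose D := x ^+ 2 + y ^+ 2.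
have D0 : 0 < D by rewrite ltr_wpDl ?sqr_ge0.
(* As |1 - u z|^2 >= y^2 / D for all u, this K gives K u |1 - u z|^2 >= 2 u x, which offsets the
   negative term of |1 - u z|^2 = 1 - 2 u x + u^2 D. *)
pose K := 2 * x * D / y ^+ 2; exists K => u u0; rewrite nE expRN.
have K0 : 0 < K by rewrite /K divr_gt0 // !mulr_gt0.
have Ku : 0 < 1 + K * u by rewrite ltr_pwDl // mulr_ge0 // ltW.
apply: (@le_trans _ _ (1 + K * u)^-1).
  by rewrite lef_pV2 ?posrE ?expR_gt0 // expR_ge1Dx.
rewrite -div1r ler_pdivrMr //.
have -> : (1 - u * x) ^+ 2 + (u * y) ^+ 2 = 1 - 2 * u * x + u ^+ 2 * D.
  by rewrite /D; ring.
have hK : 2 * x <= K * (1 - 2 * u * x + u ^+ 2 * D).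
  have yQ : y ^+ 2 <= D * (1 - 2 * u * x + u ^+ 2 * D).
    have -> : D * (1 - 2 * u * x + u ^+ 2 * D) = (D * u - x) ^+ 2 + y ^+ 2.
      by rewrite /D; ring.
    by rewrite lerDr sqr_ge0.
  by rewrite /K mulrAC ler_pdivlMr // -[leRHS]mulrA ler_wpM2l // mulr_ge0 // ltW.
have : 0 <= (u * (K * (1 - 2 * u * x + u ^+ 2 * D) - 2 * x)) by rewrite mulr_ge0 ?subr_ge0 // ltW.
have : 0 <= u ^+ 2 * D by rewrite mulr_ge0 ?sqr_ge0 // ltW.
move: (u ^+ 2 * D) => e; nra.
Qed.

(** Multiplied together, the exponential bounds on the factors depend only on the sum of the u; the
    square root undoes the square in [factor_lower_bound]. *)
Lemma pos_prod_lower_bound z (S : R) : ~ 0 < z -> exists2 d : R, 0 < d &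
  forall us, all (> 0) us -> \sum_(u <- us) u <= S ->
    d <= normc (map_poly (real_complex R) (pos_prod us)).[z].
Proof.
move=> /factor_lower_bound[K HK].
exists (Num.sqrt (expR (- (`|K| * S)))); first by rewrite sqrtr_gt0 expR_gt0.
move=> us us0 sS; rewrite -[leRHS]ger0_norm ?normc_ge0 // -[leRHS]sqrtr_sqr ler_wsqrtr //.
apply: (@le_trans _ _ (expR (- (`|K| * \sum_(u <- us) u)))).
  by rewrite ler_expR lerN2 ler_wpM2l.
rewrite /pos_prod; elim: us us0 {sS} => [|u us IH] /=.
  by move=> _; rewrite !big_nil mulr0 oppr0 expR0 rmorph1 hornerC [normc _]normc1 expr1n.
move=> /andP[u0 us0]; rewrite !big_cons rmorphM hornerM normcM exprMn mulrDr opprD expRD.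
rewrite ler_pM ?expR_ge0 ?IH //.
apply: (@le_trans _ _ (expR (- (K * u)))).
  by rewrite ler_expR lerN2 ler_wpM2r ?ler_norm // ltW.
rewrite rmorphB rmorph1 /= map_polyZ map_polyX !hornerE; exact: HK.
Qed.

Lemma pser_poly (p : {poly R}) z :
  pser (toC (fun n => p`_n)) z = (map_poly (real_complex R) p).[z].
Proof.
apply: pserE; apply: cvg_near_cst.
near=> k; rewrite (@horner_coef_wide _ k); last first.
  by rewrite size_map_poly; near: k; exact: nbhs_infty_ge.
by apply: eq_bigr => i _; rewrite coef_map.
Unshelve. all: by end_near. Qed.

Section PosProdLimit.
Variables (F : set_system nat) (us : nat -> seq R) (S : R) (h : nat -> R).
Context {FF : ProperFilter F}.
Hypothesis us0 : forall m, all (> 0) (us m).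
Hypothesis usS : \forall m \near F, \sum_(u <- us m) u <= S.
Hypothesis hP : forall n, (pos_prod (us m))`_n @[m --> F] --> h n.

Lemma pos_prod_coef_uniform (t : R) m n : 0 <= t -> \sum_(u <- us m) u <= S ->
  normc (toC (fun n => (pos_prod (us m))`_n) n) * t ^+ n <= expR (t * S).
Proof.
move=> t0 mS; rewrite normc_real (le_trans (pos_prod_coef_le n (us0 m) t0)) //.
by rewrite ler_expR ler_wpM2l.
Qed.

Lemma lim_pos_prod_coef_le (t : R) n : 0 <= t ->
  normc (toC h n) * t ^+ n <= expR (t * S).
Proof.
move=> t0; rewrite normc_real.
apply: (cvgr_to_le (f := fun m => `|(pos_prod (us m))`_n| * t ^+ n) (F := F)).
  by apply: cvgMl; exact: cvg_norm.
apply: filterS usS => m mS; have := pos_prod_coef_uniform n t0 mS.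
by rewrite normc_real.
Qed.

Lemma entire_lim_pos_prod : entire (toC h).
Proof. by move=> t t0; exists (expR (t * S)) => n; exact/lim_pos_prod_coef_le/ltW. Qed.

(** The finite products are at least d in modulus at z. If the limit vanished there, some product
    would be smaller than d: both truncation errors and the difference of the partial sums are each
    below d/4. *)
Lemma lim_pos_prod_neq0 z : ~ 0 < z -> pser (toC h) z <> 0.
Proof.
move=> zp hz0; have [d d0 Hd] := @pos_prod_lower_bound z S zp.
pose t := normc z.
pose K := expR (2 * t * S).
have K0 : 0 < K by exact: expR_gt0.
have t20 : 0 <= 2 * t by rewrite mulr_ge0 ?normc_ge0.
have [k Hk] : exists k : nat, 2 * K * 2^-1 ^+ k < d / 4.
  have : (fun k => 2 * K * 2^-1 ^+ k) @ \oo --> 2 * K * (0 : R).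
    by apply: cvgMr; apply: cvg_expr; rewrite gtr0_norm // invf_lt1 // ltr1n.
  rewrite mulr0 => /cvgr_lt /(_ (d / 4) ltac:(by rewrite divr_gt0)) /filter_ex[k ?].
  by exists k.
have T1 : normc (pser (toC h) z - psum (toC h) z k) <= 2 * K * 2^-1 ^+ k.
  apply: (@pser_tail _ _ _ t); [exact: entire_lim_pos_prod|exact: lexx|].
  by move=> n; exact: lim_pos_prod_coef_le.
have T2 : (fun m => \sum_(i < k) `|(pos_prod (us m))`_i - h i| * t ^+ i) @ F --> (0 : R).
  have Ti (i : nat) : (fun m => `|(pos_prod (us m))`_i - h i| * t ^+ i) @ F --> 0 * t ^+ i.
    have c : `|(pos_prod (us m))`_i - h i| @[m --> F] --> `|h i - h i|.
      by apply: cvg_norm; apply: cvgB; [exact: hP|exact: cvg_cst].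
    by rewrite subrr normr0 in c; apply: cvgMl.
  have e0 : \sum_(i < k) 0 * t ^+ i = 0 :> R by rewrite big1 // => i _; rewrite mul0r.
  have := cvg_sum_ord (k := k) Ti; rewrite e0. exact.
move/cvgr_lt: T2 => /(_ (d / 4) ltac:(by rewrite divr_gt0)) T2.
have [m [mS mT]] := @filter_ex _ _ FF _ (filterI usS T2).
set am := toC (fun n => (pos_prod (us m))`_n).
have T3 : normc (pser am z - psum am z k) <= 2 * K * 2^-1 ^+ k.
  apply: (@pser_tail _ _ _ t); [|exact: lexx|].
    by move=> s s0; exists (expR (s * S)) => n; exact/pos_prod_coef_uniform/mS/ltW.
  by move=> n; exact: pos_prod_coef_uniform.
have T4 : normc (psum am z k - psum (toC h) z k) < d / 4.
  apply: le_lt_trans mT; rewrite /psum -sumrB (le_trans (normc_sum _ _)) //.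
  apply: ler_sum => i _; rewrite -mulrBl normcM normcX ler_wpM2r ?exprn_ge0 ?normc_ge0 //.
  by rewrite /am /toC -rmorphB normc_real.
have := Hd (us m) (us0 m) mS; rewrite -pser_poly -/am.
rewrite hz0 sub0r normcN in T1.
have -> : pser am z = (pser am z - psum am z k) + (psum am z k - psum (toC h) z k)
   + psum (toC h) z k by rewrite subrKA subrK.
apply/negP; rewrite -ltNge.
apply: (le_lt_trans (le_normcD _ _)); apply: (le_lt_trans (lerD (le_normcD _ _) T1)).
lra.
Qed.
End PosProdLimit.
End Limits.

(** * Sign changes of coefficients *)

Section SignChanges.
Variable R : realType.
Implicit Types (a : nat -> R) (p : {poly R}).

(* The signs are those of (-1)^n a_n, so that a factor 1 - u X with u > 0 acts
   as 1 + u X. *)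
Definition sign_changes a (k : nat) := exists (s : R) (n : nat -> nat),
  (forall i, (i < k)%N -> (n i < n i.+1)%N) /\
  (forall i, (i <= k)%N -> 0 < s * (-1) ^+ i * ((-1) ^+ n i * a (n i))).

(* The n-th coefficient of (1 + u X) p being p_n + u p_(n-1), one of p_n and
   p_(n-1) has its sign. *)
Lemma sign_changes_1BcXM p (u : R) k : 0 < u ->
  sign_changes (fun n => ((1 - u *: 'X) * p)`_n) k ->
  sign_changes (fun n => p`_n) k.
Proof.
move=> u0 [s [n [n_incr n_sign]]].
pose b i m := s * (-1) ^+ i * ((-1) ^+ m * p`_m).
pose m i := if 0 < b i (n i) then n i else (n i).-1.
have m_sign i : (i <= k)%N -> 0 < b i (m i).
  move=> ik; rewrite /m; case: ifPn => //; rewrite -leNgt => bn.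
  have := n_sign i ik; rewrite coef_1BcXM; move: bn; rewrite /b.
  case: (n i) => [|j] /=; first by rewrite mulr0 subr0 => h /(le_lt_trans h); rewrite ltxx.
  rewrite mulrBr mulrBr => h; rewrite exprS => h'.
  have : 0 < u * (s * (-1) ^+ i * ((-1) ^+ j * p`_j)).
    apply: lt_le_trans h' _; move: h; rewrite exprS; move: (_ ^+ j) (_ ^+ i) => e f h.
    lra.
  by rewrite pmulr_rgt0.
exists s, m; split=> // i ik.
have le1 j : (m j <= n j)%N by rewrite /m; case: ifP => // _; exact: leq_pred.
have le2 j : ((n j).-1 <= m j)%N by rewrite /m; case: ifP => // _; exact: leq_pred.
(* Each index moves down by at most one, so order is kept weakly; equality would give one
   coefficient two opposite signs. *)
have : (m i <= m i.+1)%N.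
  apply: leq_trans (le1 i) _; apply: leq_trans (le2 i.+1).
  by have := n_incr i ik; case: (n i.+1).
rewrite leq_eqVlt => /orP[/eqP e|//].
have := m_sign i (ltnW ik); have := m_sign i.+1 ik; rewrite -e /b exprS.
by rewrite mulN1r mulrN mulNr oppr_gt0 => /lt_trans h /h; rewrite ltxx.
Qed.

Lemma sign_changes_pos_prod us p k : all (> 0) us ->
  sign_changes (fun n => (pos_prod us * p)`_n) k -> sign_changes (fun n => p`_n) k.
Proof.
elim: us p => [|u us IH] p; first by rewrite /pos_prod big_nil mul1r.
move=> /= /andP[u0 us0]; rewrite /pos_prod big_cons -/(pos_prod us) -mulrA.
by move=> /(sign_changes_1BcXM u0) /(IH _ us0).
Qed.

Lemma sign_changesZ (c : R) p k :
  sign_changes (fun n => (c *: p)`_n) k -> sign_changes (fun n => p`_n) k.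
Proof.
move=> [s [n [n_incr n_sign]]]; exists (s * c), n; split=> // i ik.
have := n_sign i ik; rewrite coefZ.
by rewrite (_ : _ * _ = s * c * (-1) ^+ i * ((-1) ^+ n i * p`_(n i))) //; ring.
Qed.

Lemma prod_XsubC_pos_prod (xs : seq R) : all (> 0) xs ->
  exists2 c : R, c != 0 &
    \prod_(x <- xs) ('X - x%:P) = c *: pos_prod [seq x^-1 | x <- xs].
Proof.
elim: xs => [|x xs IH] /=.
  by exists 1; rewrite ?oner_neq0 // /pos_prod !big_nil scale1r.
move=> /andP[x0 /IH[c c0 e]]; exists (- x * c).
  by rewrite mulf_neq0 // oppr_eq0 gt_eqF.
rewrite /pos_prod !big_cons e -/(pos_prod _) [- x * c]mulrC -scalerA -scalerAr.
congr (_ *: _); rewrite scalerAl; congr (_ * _).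
rewrite scalerBr scalerA mulNr mulfV ?gt_eqF // scaleN1r opprK addrC.
by rewrite -mul_polyC mulr1 polyCN.
Qed.

Lemma sign_changes_prod_XsubC (xs : seq R) p k : all (> 0) xs ->
  sign_changes (fun n => (p * \prod_(x <- xs) ('X - x%:P))`_n) k ->
  sign_changes (fun n => p`_n) k.
Proof.
move=> xs0; have [c _ ->] := prod_XsubC_pos_prod xs0.
rewrite mulrC -scalerAl => /sign_changesZ /sign_changes_pos_prod; apply.
by rewrite all_map; apply: sub_all xs0 => x /=; rewrite invr_gt0.
Qed.

Lemma sign_changes_size p k : sign_changes (fun n => p`_n) k -> (k < size p)%N.
Proof.
move=> [s [n [n_incr n_sign]]].
have nk : (k <= n k)%N.
  elim: k n_incr {n_sign} => // k IH h; apply: leq_ltn_trans (IH _) (h k _) => // i ik.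
  by apply: h; exact: ltnW.
rewrite (leq_ltn_trans nk) // ltnNge; apply/negP => /leq_sizeP /(_ _ (leqnn _)) e.
by have := n_sign k (leqnn k); rewrite e !mulr0 ltxx.
Qed.

(** Finitely many strict inequalities on coefficients hold simultaneously at some index of the
    filter. *)
Lemma sign_changes_lim (F : set_system nat) (Q : nat -> {poly R}) a k :
  ProperFilter F -> (forall n, (Q m)`_n @[m --> F] --> a n) ->
  sign_changes a k -> exists m, sign_changes (fun n => (Q m)`_n) k.
Proof.
move=> FF Qa [s [n [n_incr n_sign]]].
have H (i : 'I_k.+1) : \forall m \near F,
    0 < s * (-1) ^+ i * ((-1) ^+ n i * (Q m)`_(n i)).
  have c : s * (-1) ^+ i * ((-1) ^+ n i * (Q m)`_(n i)) @[m --> F] -->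
      s * (-1) ^+ i * ((-1) ^+ n i * a (n i)).
    by apply: cvgMr; apply: cvgMr; exact: Qa.
  exact: (cvgr_gt _ c _ (n_sign i (leq_ord i))).
have [m Hm] := @filter_ex _ _ FF _ (filter_forall _ H).
exists m, s, n; split=> // i ik; exact: (Hm (Ordinal (ik : (i < k.+1)%N))).
Qed.

Lemma positive_roots_factor p : p != 0 -> exists (q : {poly R}) (xs : seq R),
  [/\ p = q * \prod_(x <- xs) ('X - x%:P), all (> 0) xs & forall x, 0 < x -> ~~ root q x].
Proof.
have [n] := ubnP (size p); elim: n p => // n IH p pn p0.
have [[x x0 px]|np] := pselect (exists2 x, 0 < x & root p x); last first.
  exists p, [::]; split=> //; first by rewrite big_nil mulr1.
  by move=> x x0; apply/negP => px; apply: np; exists x.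
have /factor_theorem[q e] := px.
have q0 : q != 0 by apply: contraNneq p0 => q0; rewrite e q0 mul0r.
have [|r [xs [qe xs0 rr]]] := IH q _ q0.
  by move: pn; rewrite e size_Mmonic ?monicXsubC // size_XsubC addn2.
exists r, (rcons xs x); split=> //.
  by rewrite big_rcons /= e qe mulrA.
by rewrite all_rcons x0.
Qed.

End SignChanges.

(** * Zeros of the Wright function *)

Section Assembly.
Variable R : realType.
Local Notation C := (Cplx R).
Implicit Types (rho b : R).

Definition wright_coef rho b (n : nat) : R :=
  rGamma (rho * n%:R + b) * ((-1) ^+ n / n`!%:R).

(** * Convergence and uniform bounds for the coefficients of [gauss_poly] *)

Lemma bin_le_exp (D n : nat) : ('C(D, n) <= D ^ n)%N.
Proof.
elim: n => [|n IH]; first by rewrite bin0 expn0.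
apply: (@leq_trans (n.+1 * 'C(D, n.+1))); first by rewrite leq_pmull.
by rewrite mul_bin_left expnS leq_mul ?leq_subr.
Qed.

Lemma exp_poly_coef_le1 (D n : nat) : (0 < D)%N ->
  `|(- D%:R^-1) ^+ n *+ 'C(D, n)| <= 1 :> R.
Proof.
move=> D0; have D0R : 0 < D%:R :> R by rewrite ltr0n.
rewrite normrMn normrX normrN normfV ger0_norm // exprVn -[_ *+ 'C(_, _)]mulr_natr.
by rewrite mulrC ler_pdivrMr ?exprn_gt0 // mul1r -natrX ler_nat bin_le_exp.
Qed.

(** These are the coefficients of (1 - x/D)^D, D = m + 1, against those of exp(-x); the quotient of
    consecutive ones is -(1 - n/D)/(n + 1). *)
Lemma exp_poly_coef_cvg (n : nat) :
  (fun m => (- m.+1%:R^-1) ^+ n *+ 'C(m.+1, n)) @ \oo --> ((-1) ^+ n / n`!%:R : R).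
Proof.
elim: n => [|n IH].
  rewrite expr0 fact0 divr1; apply: cvg_near_cst; apply: nearW => m.
  by rewrite bin0.
have n1 : n.+1%:R != 0 :> R by rewrite pnatr_eq0.
have -> : (-1) ^+ n.+1 / n.+1`!%:R = (-1) ^+ n / n`!%:R * (- n.+1%:R^-1 * (1 - n%:R * 0)) :> R.
  rewrite mulr0 subr0 mulr1 exprS factS natrM invfM; ring.
have -> : (fun m => (- m.+1%:R^-1) ^+ n.+1 *+ 'C(m.+1, n.+1)) =
    (fun m => ((- m.+1%:R^-1) ^+ n *+ 'C(m.+1, n)) *
      (- n.+1%:R^-1 * (1 - n%:R * m.+1%:R^-1))) :> (nat -> R).
  apply/funext => m; have m1 : m.+1%:R != 0 :> R by rewrite pnatr_eq0.
  have e : n.+1%:R * 'C(m.+1, n.+1)%:R = (m.+1%:R - n%:R) * 'C(m.+1, n)%:R :> R.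
    rewrite -natrM mul_bin_left natrM; have [nm|nm] := leqP n m.+1; first by rewrite natrB.
    by rewrite bin_small // !mulr0.
  apply: (mulfI n1); rewrite -[_ *+ 'C(_, n.+1)]mulr_natr -[_ *+ 'C(_, n)]mulr_natr mulrCA e exprS; field.
  by rewrite nat1r m1 nat1r n1.
apply: cvgM IH _; apply: cvgMr; apply: cvgB; first exact: cvg_cst.
by apply: cvgMr; exact: cvg_harmonic.
Qed.

Lemma gauss_poly_coef_cvg rho b n :
  (gauss_poly rho b m)`_n @[m --> \oo] --> wright_coef rho b n.
Proof.
under eq_cvg => m do rewrite coef_gauss_poly.
by apply: cvgM; [exact: gauss_cvg|exact: exp_poly_coef_cvg].
Qed.

Lemma gauss_bounded (x : R) : exists K : R, forall m, `|gauss x m| <= K.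
Proof.
have [K [_ HK]] := cvg_seq_bounded (cvgP _ (@gauss_cvg R x)).
by exists (`|K| + 1) => m; apply: HK => //; rewrite (le_lt_trans (ler_norm K)) // ltrDl.
Qed.

(** From [n0] on the argument rho n + b is nonnegative and [gauss_le] gives quadratic growth in n,
    absorbed by 4^n = (2^n)^2. For each of the finitely many smaller n a convergent sequence is
    bounded. *)
Lemma gauss_poly_coef_le rho b : 0 < rho -> exists K : R, forall m n, (0 < m)%N ->
  `|(gauss_poly rho b m)`_n| <= K * 4 ^+ n.
Proof.
move=> rho0.
suff [K HK] : exists K : R, forall m n, (0 < m)%N ->
    `|gauss (rho * n%:R + b) m| <= K * 4 ^+ n.
  exists K => m n m0; rewrite coef_gauss_poly normrM -[leRHS]mulr1.
  by rewrite ler_pM ?HK ?exp_poly_coef_le1.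
have [Kf HKf] := choice (fun n : nat => gauss_bounded (rho * n%:R + b)).
pose n0 := (Num.trunc (`|b| / rho)).+1.
pose k := rho + `|b| + 1.
have k1 : 1 <= k by rewrite /k lerDr addr_ge0 // ltW.
exists (2 * k ^+ 2 + \sum_(i < n0) `|Kf i|) => m n m0.
have p4 : 1 <= 4 ^+ n :> R by rewrite exprn_ege1 // ler1n.
have s0 : 0 <= \sum_(i < n0) `|Kf i| by rewrite sumr_ge0.
have [nn|nn] := ltnP n n0.
  apply: (le_trans (HKf n m)); apply: (le_trans (ler_norm _)).
  have h : `|Kf n| <= \sum_(i < n0) `|Kf i|.
    by rewrite (bigD1 (Ordinal nn)) //= lerDl sumr_ge0.
  have k2 : 0 <= k ^+ 2 by rewrite sqr_ge0.
  nra.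
have x0 : 0 <= rho * n%:R + b.
  have h : `|b| / rho < n%:R.
    by rewrite (lt_le_trans (truncnS_gt _)) // ler_nat.
  rewrite ltr_pdivrMr // in h; have := ler_norm (- b); rewrite normrN; lra.
rewrite ger0_norm ?gauss_ge0 // (le_trans (gauss_le x0 m0)) //.
set x := rho * n%:R + b in x0 *.
have n2 : n%:R + 1 <= 2 ^+ n :> R by rewrite natr1 -natrX ler_nat ltn_expl.
have xk : x <= k * 2 ^+ n.
  apply: (@le_trans _ _ (k * (n%:R + 1))); last by rewrite ler_wpM2l //; lra.
  rewrite /x /k; have := ler_norm b; have : 0 <= n%:R :> R by [].
  have : 0 <= `|b| * n%:R by rewrite mulr_ge0. nra.
have e4 : 4 ^+ n = 2 ^+ n * 2 ^+ n :> R.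
  by rewrite -exprMn; congr (_ ^+ _); rewrite -natrM.
have q1 : 1 <= k * 2 ^+ n.
  by rewrite mulr_ege1 // exprn_ege1 // ler1n.
apply: (@le_trans _ _ ((k * 2 ^+ n) * (k * 2 ^+ n + 1))).
  have x1 : x + 1 <= k * 2 ^+ n + 1 by rewrite lerD2r.
  by rewrite ler_pM // addr_ge0.
rewrite e4; set q := 2 ^+ n.
have : 0 <= (\sum_(i < n0) `|Kf i|) * (q * q) by rewrite mulr_ge0 // mulr_ge0 // exprn_ge0.
rewrite -/q in q1.
have : k * q * (k * q + 1) <= k * q * (2 * (k * q)) by rewrite ler_wpM2l //; lra.
move: (\sum_(i < n0) _) => sK; lra. 
Qed.

(** * Factorisation of the Wright series and count of its zeros *)

Lemma gauss_eq0 (k m : nat) : (k <= m)%N -> gauss (- k%:R : R) m = 0.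
Proof.
move=> km; rewrite /gauss (bigD1 (Ordinal (km : (k < m.+1)%N))) //=.
by rewrite addNr !mul0r.
Qed.

(** Degree count: after division by X^p the degree is at most m + 1 - p, and m + 1 - N distinct
    positive roots split off. The last clause is separate because N - p is truncated to 0 when p >
    N. *)
Lemma gauss_poly_factor rho b (N p m : nat) : 0 < rho -> 0 < b + N%:R ->
  (0 < m)%N -> (N <= m)%N -> (p <= m)%N -> `|b| <= m%:R ->
  (forall n, (n < p)%N -> exists k : nat, rho * n%:R + b = - k%:R) ->
  exists uW : seq R * {poly R},
   [/\ all (> 0) uW.1, drop_poly p (gauss_poly rho b m) = pos_prod uW.1 * uW.2,
       (size uW.2 <= (N - p).+1)%N & uW.2 != 0 -> (p <= N)%N].
Proof.
move=> rho0 bN m0 Nm pm bm pz.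
have [xs [ux sx rx]] := gauss_poly_roots rho0 bN m0 (leqW Nm).
set P := drop_poly p _.
have PE : gauss_poly rho b m = P * 'X^p.
  (* The first p coefficients vanish before any limit: |b| <= m places the poles concerned within
     the range of Gauss's product. *)
  rewrite -[LHS](poly_take_drop p) (_ : take_poly p _ = 0) ?add0r //.
  apply/polyP => i; rewrite coef_take_poly coef0; case: ltnP => // ip.
  rewrite coef_gauss_poly; have [k e] := pz i ip; rewrite e gauss_eq0 ?mul0r //.
  rewrite -(ler_nat R); apply: le_trans bm; rewrite -normrN; apply: le_trans (ler_norm _).
  have -> : k%:R = - b - rho * i%:R by rewrite -[LHS]opprK -e; ring.
  by rewrite gerBl mulr_ge0 // ltW.
have rP : all (root P) xs.
  apply/allP => x /rx[x0]; rewrite PE rootM => /orP[//|].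
  by rewrite rootE hornerXn expf_eq0 gt_eqF // andbF.
have [q qE] : exists q : {poly R}, P = q * \prod_(x <- xs) ('X - x%:P).
  exact: uniq_roots_prod_XsubC rP (eq_trans (uniq_rootsE xs) ux).
have xs0 : all (> 0) xs by apply/allP => x /rx[].
have [c c0 cE] := prod_XsubC_pos_prod xs0.
exists ([seq x^-1 | x <- xs], c *: q); split => /=.
- by rewrite all_map; apply: sub_all xs0 => x /=; rewrite invr_gt0.
- by rewrite qE cE -!scalerAr mulrC.
- rewrite size_scale //; have [->|q0] := eqVneq q 0; first by rewrite size_poly0.
  have : (size P <= m.+2 - p)%N by rewrite size_drop_poly leq_sub2r // size_poly.
  rewrite qE size_Mmonic ?monic_prod_XsubC // size_prod_XsubC sx.
  have q1 : (0 < size q)%N by rewrite size_poly_gt0.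
  move: (size q) q1 => s; lia.
- rewrite scale_poly_eq0 negb_or => /andP[_ q0].
  have : (size P <= m.+2 - p)%N by rewrite size_drop_poly leq_sub2r // size_poly.
  rewrite qE size_Mmonic ?monic_prod_XsubC // size_prod_XsubC sx.
  have q1 : (0 < size q)%N by rewrite size_poly_gt0.
  lia.
Qed.

Lemma toC_shift (a : nat -> R) p : (forall n, (n < p)%N -> a n = 0) ->
  toC a = foldr (@mulXB R) (toC (fun n => a (n + p)%N)) (nseq p 0).
Proof.
elim: p a => [|p IH] a a0.
  by congr toC; apply/funext => n; rewrite addn0.
have -> : toC a = mulXB 0 (toC (fun n => a n.+1)).
  apply/funext => -[|n]; rewrite /mulXB mul0r subr0 /toC // a0 //.
rewrite (IH (fun n => a n.+1)) /=; last by move=> n np; apply: a0.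
by under [in RHS]eq_fun => n do rewrite addnS.
Qed.

Lemma toC_conv (Q : {poly R}) (a h : nat -> R) :
  (forall n, a n = \sum_(i < n.+1) Q`_i * h (n - i)%N) ->
  toC a = convp (map_poly (real_complex R) Q) (toC h).
Proof.
move=> aE; apply/funext => n; rewrite /toC aE /convp rmorph_sum.
by apply: eq_bigr => i _; rewrite rmorphM coef_map.
Qed.

(** [zs] consists of p times 0 and of the roots, other than positive ones, of the limit polynomial Q
    of [ultra_factor]. Degrees bound its size from above, sign changes from below. *)
Lemma wright_factor rho b (N p : nat) : 0 < rho -> 0 < b + N%:R ->
  (forall n, (n < p)%N -> exists k : nat, rho * n%:R + b = - k%:R) ->
  wright_coef rho b p != 0 ->
  exists (zs : seq C) (g : nat -> C),
   [/\ entire g, forall z, ~ 0 < z -> pser g z <> 0,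
       forall z, z \in zs -> ~ 0 < z,
       toC (wright_coef rho b) = foldr (@mulXB R) g zs &
       (size zs <= N)%N /\
       forall k, sign_changes (fun n => wright_coef rho b (n + p)) k -> (k + p <= size zs)%N].
Proof.
move=> rho0 bN pz ap0.
pose m0 := (N + p + (Num.trunc `|b|).+1)%N.
have bm m : `|b| <= (m + m0)%:R.
  apply: ltW; rewrite (lt_le_trans (truncnS_gt _)) // ler_nat.
  by rewrite (leq_trans _ (leq_addl m _)) // leq_addl.
have H m := @gauss_poly_factor rho b N p (m + m0) rho0 bN ltac:(rewrite /m0; lia)
  ltac:(rewrite /m0; lia) ltac:(rewrite /m0; lia) (bm m) pz.
have [uW HuW] := choice H.
have [K HK] := gauss_poly_coef_le b rho0.
have Pcvg n : (drop_poly p (gauss_poly rho b (m + m0)))`_n @[m --> \oo] -->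
    wright_coef rho b (n + p).
  have := @gauss_poly_coef_cvg rho b (n + p); rewrite -(cvg_shiftn m0).
  by under eq_fun => m do rewrite -coef_drop_poly.
have Pbound m n : `|(drop_poly p (gauss_poly rho b (m + m0)))`_n| <= K * 4 ^+ p * 4 ^+ n.
  by rewrite coef_drop_poly -mulrA -exprD [(p + n)%N]addnC HK // /m0 !addnS.
(* The coefficient of index p has a nonzero limit, so some cofactor is nonzero. *)
have pN : (p <= N)%N.
  have : (fun m => `|(drop_poly p (gauss_poly rho b (m + m0)))`_0|) @ \oo --> `|wright_coef rho b (0 + p)|.
    by apply: cvg_norm.
  move=> /cvgr_gt /(_ 0); rewrite add0n normr_gt0 => /(_ ap0) /filter_ex[m].
  rewrite normr_gt0 => c0; have [_ e _ h] := HuW m; apply: h.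
  by apply: contraNneq c0 => h; rewrite e h mulr0 coef0.
have [F [S [h [Q [FF FS hP [sQ Q0 QE]]]]]] := @ultra_factor R
  (fun m => drop_poly p (gauss_poly rho b (m + m0))) (fun m => (uW m).2) (fun m => (uW m).1)
  (fun n => wright_coef rho b (n + p)) (N - p) _ 4 ltac:(by rewrite ltr0n)
  ltac:(by move=> m; have [] := HuW m) ltac:(by move=> m; have [] := HuW m)
  ltac:(by move=> m; have [] := HuW m) Pbound Pcvg ap0.
have us0 m : all (> 0) (uW m).1 by have [] := HuW m.
have Qn0 : Q != 0 by apply: contraNneq Q0 => ->; rewrite coef0.
have [q [xs [qE xs0 rq]]] := positive_roots_factor Qn0.
have qn0 : q != 0 by apply: contraNneq Qn0 => q0; rewrite qE q0 mul0r.
have [ws wsE] := closed_field_poly_normal (map_poly (real_complex R) q : {poly C}).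
set c := lead_coef _ in wsE.
have c0 : c != 0 by rewrite lead_coef_eq0 map_poly_eq0.
have sws : size ws = (size q).-1.
  rewrite -(size_map_poly (real_complex R) q) wsE size_scale // size_prod_XsubC //.
have eh : entire (toC h) by exact: entire_lim_pos_prod us0 FS hP.
have hn0 z : ~ 0 < z -> pser (toC h) z <> 0 by exact: lim_pos_prod_neq0 us0 FS hP _.
(* The positive roots of Q are left in [g], which must be zero-free only outside ]0, +oo[. *)
pose g := foldr (@mulXB R) (fun n => c * toC h n) [seq x%:C%C | x <- xs].
exists (nseq p 0 ++ ws), g; split.
- by apply: entire_foldr; exact: entireZ.
- move=> z z0; rewrite pser_foldr; last exact: entireZ.
  rewrite pserZ //; apply/eqP; rewrite !mulf_neq0 //; last exact/eqP/hn0.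
  rewrite prodf_seq_neq0; apply/allP => _ /mapP[x xx ->] /=.
  rewrite subr_eq0; apply/eqP => zx; apply: z0; rewrite zx ltcR.
  exact: (allP xs0).
- move=> z; rewrite mem_cat => /orP[/nseqP[-> _]|zw]; first by rewrite ltxx.
  move=> /ltc0_real[x x0 zx].
  have : root (map_poly (real_complex R) q) x%:C%C.
    by rewrite wsE rootZ // root_prod_XsubC -zx.
  by rewrite /root horner_map /= fmorph_eq0; apply/negP; exact: rq.
- rewrite foldr_cat (@toC_shift _ p) => [|n np]; last first.
    by have [k e] := pz n np; rewrite /wright_coef e rGammaN_nat mul0r.
  congr foldr; rewrite (toC_conv QE) qE rmorphM /= wsE rmorph_prod /= -scalerAl.
  have -> : \prod_(x <- xs) map_poly (real_complex R) ('X - x%:P) =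
      \prod_(z <- [seq x%:C%C | x <- xs]) ('X - z%:P) :> {poly C}.
    by rewrite big_map; apply: eq_bigr => x _; rewrite rmorphB /= map_polyX map_polyC.
  have ch : (fun n => c * toC h n) = convp (c *: 1) (toC h) by rewrite convpZ convp1.
  by rewrite /g ch -!convp_prod -!scalerAr mulr1.
- rewrite size_cat size_nseq sws; split.
    have : (size q <= size Q)%N.
      by rewrite qE size_Mmonic ?monic_prod_XsubC // size_prod_XsubC addnS leq_addr.
    move: sQ; lia.
  (* The limit is approached by [pos_prod] times the fixed polynomial Q; sign changes then descend
     to Q and to its factor q, and bound the degree of q from below. *)
  have Qcvg n : (pos_prod (uW m).1 * Q)`_n @[m --> F] --> wright_coef rho b (n + p).
    rewrite QE (_ : (fun m => _) =
      fun m => \sum_(i < n.+1) Q`_i * (pos_prod (uW m).1)`_(n - i)); last first.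
      by apply/funext => m; rewrite mulrC coefM.
    have Qi i : Q`_i * (pos_prod (uW m).1)`_(n - i) @[m --> F] --> Q`_i * h (n - i)%N.
      by apply: cvgMr; exact: hP.
    exact: cvg_sum_ord Qi.
  move=> k /(sign_changes_lim FF Qcvg)[m] /(sign_changes_pos_prod (us0 m)).
  rewrite qE => /(sign_changes_prod_XsubC xs0) /sign_changes_size kq.
  by rewrite addnC leq_add2l -ltnS prednK // size_poly_gt0.
Qed.

Lemma Wright_pser rho b (z : C) : Wright rho b (- z) = pser (toC (wright_coef rho b)) z.
Proof.
rewrite /Wright /pser; congr (limn _); apply/funext => k.
rewrite /series /= big_mkord /psum; apply: eq_bigr => i _.
have e : ((-1) ^+ i / i`!%:R : R)%:C%C = (-1) ^+ i / i`!%:R :> C.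
  by rewrite rmorphM fmorphV rmorph_nat rmorphXn rmorphN1.
rewrite exprNn /toC /wright_coef rmorphM [X in _ = _ * X * _]e.
by rewrite !mulrA mulrAC -!mulrA; congr (_ * _); rewrite mulrCA.
Qed.

(** On ]-k, 1-k[ the function 1/Gamma has the sign (-1)^k, so one argument in each interval, from k
    = K down to k = 0, yields K changes. *)
Lemma wright_sign_changes rho b (p K : nat) : 0 < rho ->
  (forall k, (k <= K)%N -> exists n : nat,
    - k%:R < rho * (n + p)%:R + b /\ ((0 < k)%N ==> (rho * (n + p)%:R + b < 1 - k%:R))) ->
  sign_changes (fun n => wright_coef rho b (n + p)) K.
Proof.
move=> rho0 H.
have H' i : exists n : nat, (i <= K)%N -> - (K - i)%:R < rho * (n + p)%:R + b /\
    ((0 < K - i)%N ==> (rho * (n + p)%:R + b < 1 - (K - i)%:R)).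
  by have [n hn] := H (K - i)%N (leq_subr _ _); exists n.
have [n Hn] := choice H'.
(* The factor (-1)^K is due to visiting the intervals in decreasing order of k, and (-1)^p to the
   index shift. *)
exists ((-1) ^+ K * (-1) ^+ p), n; split=> i iK.
  have [_] := Hn i (ltnW iK); rewrite subn_gt0 iK /= => h.
  have [h' _] := Hn i.+1 iK.
  have : rho * (n i + p)%:R + b < rho * (n i.+1 + p)%:R + b.
    apply: lt_trans h _; apply: le_lt_trans h'.
    by rewrite -[(K - i)%N]prednK ?subn_gt0 // -subnS -natr1; lra.
  by rewrite ltrD2r ltr_pM2l // ltr_nat ltn_add2r.
have [h1 h2] := Hn i iK; have := rGamma_sign h1 h2.
rewrite /wright_coef => h.
have e1 : (-1) ^+ n i * (-1) ^+ (n i + p) = (-1) ^+ p :> R.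
  by rewrite exprD mulrA -exprMn mulrNN mulr1 expr1n mul1r.
have e2 : (-1) ^+ p * (-1) ^+ p = 1 :> R by rewrite -exprMn mulrNN mulr1 expr1n.
have e3 : (-1) ^+ K * (-1) ^+ i = (-1) ^+ (K - i) :> R.
  rewrite -[in X in _ ^+ X * _](subnK iK) exprD -mulrA -exprMn mulrNN mulr1 expr1n.
  by rewrite mulr1.
rewrite [ltRHS](_ : _ = ((-1) ^+ K * (-1) ^+ i) * rGamma (rho * (n i + p)%:R + b) *
  ((-1) ^+ p * ((-1) ^+ n i * (-1) ^+ (n i + p))) / (n i + p)`!%:R); last first.
  move: (rGamma _) (_^-1) ((-1) ^+ (n i + p)) ((-1) ^+ n i) => x y u v.
  by move: ((-1) ^+ p) ((-1) ^+ i) ((-1) ^+ K) => a c d; ring.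
by rewrite e1 e2 e3 mulr1 divr_gt0 // ltr0n fact_gt0.
Qed.

End Assembly.

(** Starting in ]-K, 1-K[ with steps rho <= 1, the arguments can miss an interval ]-k, 1-k[ only by
    going from -k to 1 - k exactly, which the last hypothesis excludes. Hence K sign changes occur,
    and the lower bound meets the upper bound K + p. *)
Lemma Wright_zero_count (R : realType) (rho b : R) (p K : nat) :
  0 < rho -> rho <= 1 ->
  (forall n, (n < p)%N -> exists k : nat, rho * n%:R + b = - k%:R) ->
  - K%:R < rho * p%:R + b -> (0 < K)%N ==> (rho * p%:R + b < 1 - K%:R) ->
  0 < b + (K + p)%:R ->
  (forall n k : nat, (k < K)%N -> rho * n%:R + b = - k%:R -> rho < 1) ->
  nonpos_zero_count (fun z : Cplx R => Wright rho b (- z)) (K + p).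
Proof.
move=> rho0 rho1 pz xK xK' bN rho_lt1.
have ap0 : wright_coef rho b p != 0.
  have := rGamma_sign xK xK'; rewrite /wright_coef => h.
  rewrite mulf_neq0 //; first by apply: contraTneq h => ->; rewrite mulr0 ltxx.
  by rewrite mulf_neq0 ?signr_eq0 // invr_eq0 pnatr_eq0 -lt0n fact_gt0.
have [zs [g [eg g0 zs0 aE [zsN zsK]]]] := wright_factor rho0 bN pz ap0.
have sc : sign_changes (fun n => wright_coef rho b (n + p)) K.
  apply: wright_sign_changes => // k kK.
  move: (kK); rewrite leq_eqVlt => /orP[/eqP ->|kltK]; first by exists 0%N.
  have ex : exists n : nat, - k%:R < rho * (n + p)%:R + b.
    exists (Num.trunc (`|b| / rho)).+1.
    have := truncnS_gt (`|b| / rho); set t := _.+1; rewrite ltr_pdivrMr // => h.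
    have := ler_norm (- b); rewrite normrN natrD => hb.
    have : 0 <= rho * p%:R by rewrite mulr_ge0 // ltW.
    have : 0 <= k%:R :> R by []. lra.
  (* The first argument beyond -k: its predecessor is at most -k, so it is itself at most 1 - k. *)
  have [n xn nmin] := ex_minnP ex; exists n; split=> //; apply/implyP => _.
  case: n xn nmin => [|n] xn nmin.
    (* The initial argument is below 1 - K <= -k, so it cannot be the first one beyond -k. *)
    move: xK'; rewrite (leq_trans _ kltK) //= => xK'; have : k.+1%:R <= K%:R :> R by rewrite ler_nat.
    by rewrite add0n -natr1 in xn *; lra.
  have xn' : rho * (n + p)%:R + b <= - k%:R.
    by rewrite leNgt; apply/negP => /nmin; rewrite ltnn.
  rewrite addSn -natr1 mulrDr mulr1 in xn *.
  move: xn'; rewrite le_eqVlt => /orP[/eqP e|]; last by lra.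
  by have := rho_lt1 _ _ kltK e; lra.
have szs : size zs = (K + p)%N by apply/eqP; rewrite eqn_leq zsN zsK.
have -> : (fun z : Cplx R => Wright rho b (- z)) = pser (foldr (@mulXB R) g zs).
  by apply/funext => z; rewrite Wright_pser aE.
by rewrite -szs; exact: nonpos_zero_count_prod.
Qed.

Theorem theorem1 (R : realType) (rho beta : R) :
  (0 < rho -> 0 < beta ->
     forall z : Cplx R, Wright rho beta (- z) = 0 -> 0 < z) /\
  (0 < rho -> rho <= 1 -> 0 < beta ->
     nonpos_zero_count (fun z : Cplx R => Wright rho (- beta) (- z))
       `|Num.floor beta|%N.+1).
Proof.
split=> [rho0 beta0 z|rho0 rho1 beta0].
  have ap0 : wright_coef rho beta 0 != 0.
    by rewrite /wright_coef mulr0 add0r expr0 fact0 divr1 mulr1 gt_eqF ?rGamma_gt0.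
  (* With N = 0 no factor z - w is left, and the series is the zero-free [g]. *)
  have [||zs [g [eg g0 _ aE [zs0 _]]]] := @wright_factor R rho beta 0 0 rho0 _ _ ap0.
  - by rewrite addr0.
  - by [].
  rewrite Wright_pser aE; move: zs0; rewrite leqn0 size_eq0 => /eqP -> /= gz.
  by apply: contrapT => /g0.
set n := `|Num.floor beta|%N.
have nE : n%:Z = Num.floor beta by rewrite gez0_abs // floor_ge0 ltW.
have nb : n%:R <= beta by have := floor_le_tmp beta; rewrite -nE.
have bn : beta < n.+1%:R by have := floorD1_gt beta; rewrite -nE -natr1 intrD.
(* The pair (p, K), with K + p = n + 1, is (0, n + 1) if beta is not an integer; (n + 1, 0) if beta
   = n and rho = 1, when 0 is a zero of order n + 1; and (1, n) if beta = n and rho < 1, when 0 is a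
   simple zero. *)
have [nb'|nb'] := eqVneq n%:R beta; last first.
  have {nb nb'} nb : n%:R < beta by rewrite lt_neqAle nb'.
  rewrite -[n.+1]addn0; apply: Wright_zero_count => //.
  - by rewrite mulr0 add0r ltrN2.
  - by rewrite mulr0 add0r -natr1 /=; lra.
  - by rewrite addn0 addrC subr_gt0.
  move=> i k _ e; rewrite lt_neqAle rho1 andbT; apply/eqP => r1.
  have be : beta = (i + k)%:R by rewrite natrD; rewrite r1 in e; lra.
  by move: nb bn; rewrite be !ltr_nat ltnS => /leq_trans h /h; rewrite ltnn.
have [r1|r1] := eqVneq rho 1.
  rewrite -[n.+1]add0n; apply: Wright_zero_count => //.
  - move=> i; rewrite ltnS => ik; exists (n - i)%N; rewrite r1 -nb' natrB //; ring.
  - by rewrite r1 -nb' -natr1; lra.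
  - by rewrite add0n -nb' -natr1; lra.
have {}r1 : rho < 1 by rewrite lt_neqAle r1.
rewrite -addn1; apply: Wright_zero_count => //.
- by move=> [|//] _; exists n; rewrite mulr0 add0r nb'.
- by rewrite -nb'; lra.
- by rewrite -nb'; apply/implyP; lra.
- by rewrite natrD -nb'; lra.
Qed.
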